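(* The lattice of graded ideals of a Leavitt path algebra is a Morita invariant: if $\mathbb{F}$ is a field and $\Gamma,\Lambda$ are arbitrary digraphs such that $L_{\mathbb{F}}(\Gamma)$ and $L_{\mathbb{F}}(\Lambda)$ are Morita equivalent, then the lattices (under inclusion) of graded ideals of $L_{\mathbb{F}}(\Gamma)$ and of $L_{\mathbb{F}}(\Lambda)$ are isomorphic.
   Context: A digraph $\Gamma=(V,E,s,t)$ consists of arbitrary (possibly infinite) sets $V$ of vertices and $E$ of arrows and functions $s,t:E\to V$ (source, target). The Leavitt path algebra $L_{\mathbb{F}}(\Gamma)$ is the (not necessarily unital) $\mathbb{F}$-algebra generated by $V\sqcup E\sqcup\{e^*: e\in E\}$ subject to: $uv=\delta_{u,v}u$ for $u,v\in V$; $s(e)e=e=e\,t(e)$ and $t(e)e^*=e^*=e^*s(e)$ for $e\in E$; (CK1) $e^*f=\delta_{e,f}t(e)$; (CK2) $v=\sum_{s(e)=v}ee^*$ for every $v$ with $0<|s^{-1}(v)|<\infty$. It is $\mathbb{Z}$-graded with $\deg v=0$, $\deg e=1$, $\deg e^*=-1$; graded (two-sided) ideals are with respect to this standard grading. Two such algebras (which have local units) are Morita equivalent if their categories of unital right modules (modules $M$ with $M=MA$) are equivalent; the equivalence is not assumed to respect gradings. *)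

(* Defs.v *)
From HB Require Import structures.
From mathcomp Require Import all_boot all_order all_algebra.
From mathcomp Require Import boolp classical_sets.
From Stdlib Require List.

Set Implicit Arguments.
Unset Strict Implicit.
Unset Printing Implicit Defensive.

Import Order.TTheory GRing.Theory.
Local Open Scope ring_scope.
Local Open Scope quotient_scope.

HB.mixin Record Lmodule_isNuAlgebra (F : fieldType) A of GRing.Lmodule F A := {
  numul : A -> A -> A;
  numulA : associative numul;
  numulDl : left_distributive numul +%R;
  numulDr : right_distributive numul +%R;
  nuscaleAl : forall (a : F) (x y : A), a *: numul x y = numul (a *: x) y;
  nuscaleAr : forall (a : F) (x y : A), a *: numul x y = numul x (a *: y)
}.

#[short(type="nuAlgType")]
HB.structure Definition NuAlgebra (F : fieldType) :=
  {A of GRing.Lmodule F A & Lmodule_isNuAlgebra F A}.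

Local Notation "x ** y" := (numul x y) (at level 40, left associativity).

Section NuAlgebraTheory.
Variables (F : fieldType) (A : nuAlgType F).
Implicit Types x y z : A.

Lemma numul0r x : 0 ** x = 0.
Proof. by rewrite -[X in X ** _](scale0r 0) -nuscaleAl scale0r. Qed.

Lemma numulr0 x : x ** 0 = 0.
Proof. by rewrite -[X in _ ** X](scale0r 0) -nuscaleAr scale0r. Qed.

Lemma numul_suml (T : Type) (s : seq T) (G : T -> A) y :
  (\sum_(i <- s) G i) ** y = \sum_(i <- s) G i ** y.
Proof.
elim: s => [|i s IHs]; first by rewrite !big_nil numul0r.
by rewrite !big_cons numulDl IHs.
Qed.

Definition is_ideal (I : set A) : Prop :=
  [/\ I 0,
      forall x y, I x -> I y -> I (x + y),
      forall (a : F) x, I x -> I (a *: x)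
    & forall x y, I x -> I (y ** x) /\ I (x ** y)].

(* [H n] is the homogeneous component of degree [n]; the second clause is
   I = \sum_n (I :&: H n). *)
Definition is_graded_ideal (H : int -> set A) (I : set A) : Prop :=
  is_ideal I /\
  forall x, I x -> exists s : seq (int * A),
    (forall p, p \in s -> H p.1 p.2 /\ I p.2) /\ x = \sum_(p <- s) p.2.

End NuAlgebraTheory.

Section Presentation.
Variables (F : fieldType) (X : Type).

Inductive fterm : Type :=
  | FGen of X
  | FZero
  | FAdd of fterm & fterm
  | FScale of F & fterm
  | FMul of fterm & fterm.

HB.instance Definition _ := gen_eqMixin fterm.
HB.instance Definition _ := gen_choiceMixin fterm.

Variable R : fterm -> fterm -> Prop.

(* The congruence generated by [R] and the axioms of non-unital associative
   F-algebras, so that the quotient has the universal property of the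
   presentation. *)
Inductive fcongr : fterm -> fterm -> Prop :=
  | fc_rel s t : R s t -> fcongr s t
  | fc_refl t : fcongr t t
  | fc_sym s t : fcongr s t -> fcongr t s
  | fc_trans s t u : fcongr s t -> fcongr t u -> fcongr s u
  | fc_add s s' t t' :
      fcongr s s' -> fcongr t t' -> fcongr (FAdd s t) (FAdd s' t')
  | fc_scale a t t' : fcongr t t' -> fcongr (FScale a t) (FScale a t')
  | fc_mul s s' t t' :
      fcongr s s' -> fcongr t t' -> fcongr (FMul s t) (FMul s' t')
  | fc_addA s t u : fcongr (FAdd s (FAdd t u)) (FAdd (FAdd s t) u)
  | fc_addC s t : fcongr (FAdd s t) (FAdd t s)
  | fc_add0 t : fcongr (FAdd FZero t) t
  | fc_addN t : fcongr (FAdd (FScale (-1) t) t) FZero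
  | fc_scaleA a b t : fcongr (FScale a (FScale b t)) (FScale (a * b) t)
  | fc_scale1 t : fcongr (FScale 1 t) t
  | fc_scaleDr a s t :
      fcongr (FScale a (FAdd s t)) (FAdd (FScale a s) (FScale a t))
  | fc_scaleDl a b t :
      fcongr (FScale (a + b) t) (FAdd (FScale a t) (FScale b t))
  | fc_mulA s t u : fcongr (FMul s (FMul t u)) (FMul (FMul s t) u)
  | fc_mulDl s t u : fcongr (FMul (FAdd s t) u) (FAdd (FMul s u) (FMul t u))
  | fc_mulDr s t u : fcongr (FMul s (FAdd t u)) (FAdd (FMul s t) (FMul s u))
  | fc_scaleAl a s t : fcongr (FScale a (FMul s t)) (FMul (FScale a s) t)
  | fc_scaleAr a s t : fcongr (FScale a (FMul s t)) (FMul s (FScale a t)).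

Definition fequiv (s t : fterm) : bool := `[< fcongr s t >].

Lemma fequiv_refl : reflexive fequiv.
Proof. by move=> t; apply/asboolP/fc_refl. Qed.

Lemma fequiv_sym : symmetric fequiv.
Proof. by move=> s t; apply/asboolP/asboolP => /fc_sym. Qed.

Lemma fequiv_trans : transitive fequiv.
Proof. by move=> t s u /asboolP st /asboolP tu; apply/asboolP/fc_trans/tu. Qed.

Canonical fequiv_equiv := EquivRel fequiv fequiv_refl fequiv_sym fequiv_trans.

Definition presented := {eq_quot fequiv}.

HB.instance Definition _ := Choice.on presented.
HB.instance Definition _ := EqQuotient.on presented.

Lemma presentedP (s t : fterm) :
  fcongr s t <-> \pi_presented s = \pi_presented t.
Proof.
split=> [st|/eqquotP /asboolP //].
by apply/eqquotP/asboolP.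
Qed.

Definition pzero : presented := \pi_presented FZero.
Definition padd (x y : presented) : presented := \pi_presented (FAdd (repr x) (repr y)).
Definition pscale (a : F) (x : presented) : presented :=
  \pi_presented (FScale a (repr x)).
Definition pmul (x y : presented) : presented := \pi_presented (FMul (repr x) (repr y)).

Lemma repr_pi (t : fterm) : fcongr (repr (\pi_presented t)) t.
Proof. by apply/presentedP; rewrite reprK. Qed.

Lemma padd_pi s t : padd (\pi_presented s) (\pi_presented t) = \pi_presented (FAdd s t).
Proof. by apply/presentedP/fc_add; apply: repr_pi. Qed.

Lemma pscale_pi a t : pscale a (\pi_presented t) = \pi_presented (FScale a t).
Proof. by apply/presentedP/fc_scale/repr_pi. Qed.

Lemma pmul_pi s t : pmul (\pi_presented s) (\pi_presented t) = \pi_presented (FMul s t).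
Proof. by apply/presentedP/fc_mul; apply: repr_pi. Qed.

Lemma presented_ind (P : presented -> Prop) :
  (forall t, P (\pi_presented t)) -> forall x, P x.
Proof. by move=> Ppi x; rewrite -(reprK x). Qed.

Lemma paddA : associative padd.
Proof.
elim/presented_ind => s; elim/presented_ind => t; elim/presented_ind => u.
by rewrite !padd_pi; apply/presentedP/fc_addA.
Qed.

Lemma paddC : commutative padd.
Proof.
elim/presented_ind => s; elim/presented_ind => t.
by rewrite !padd_pi; apply/presentedP/fc_addC.
Qed.

Lemma padd0 : left_id pzero padd.
Proof.
by elim/presented_ind => t; rewrite padd_pi; apply/presentedP/fc_add0.
Qed.

Lemma paddN : left_inverse pzero (pscale (-1)) padd.
Proof.
elim/presented_ind => t.
by rewrite pscale_pi padd_pi; apply/presentedP/fc_addN.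
Qed.

HB.instance Definition _ :=
  GRing.isZmodule.Build presented paddA paddC padd0 paddN.

Lemma pscaleA a b (x : presented) :
  pscale a (pscale b x) = pscale (a * b) x.
Proof.
elim/presented_ind: x => t.
by rewrite !pscale_pi; apply/presentedP/fc_scaleA.
Qed.

Lemma pscale1 : left_id 1 pscale.
Proof.
by elim/presented_ind => t; rewrite pscale_pi; apply/presentedP/fc_scale1.
Qed.

Lemma pscaleDr : right_distributive pscale padd.
Proof.
move=> a; elim/presented_ind => s; elim/presented_ind => t.
by rewrite !(padd_pi, pscale_pi); apply/presentedP/fc_scaleDr.
Qed.

Lemma pscaleDl (x : presented) :
  {morph pscale^~ x : a b / a + b >-> padd a b}.
Proof.
move=> a b; elim/presented_ind: x => t.
by rewrite !(padd_pi, pscale_pi); apply/presentedP/fc_scaleDl.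
Qed.

HB.instance Definition _ := GRing.Zmodule_isLmodule.Build F presented
  pscaleA pscale1 pscaleDr pscaleDl.

Lemma pmulA : associative pmul.
Proof.
elim/presented_ind => s; elim/presented_ind => t; elim/presented_ind => u.
by rewrite !pmul_pi; apply/presentedP/fc_mulA.
Qed.

Lemma pmulDl : left_distributive pmul padd.
Proof.
elim/presented_ind => s; elim/presented_ind => t; elim/presented_ind => u.
by rewrite !(padd_pi, pmul_pi); apply/presentedP/fc_mulDl.
Qed.

Lemma pmulDr : right_distributive pmul padd.
Proof.
elim/presented_ind => s; elim/presented_ind => t; elim/presented_ind => u.
by rewrite !(padd_pi, pmul_pi); apply/presentedP/fc_mulDr.
Qed.

Lemma pscaleAl a (x y : presented) : pscale a (pmul x y) = pmul (pscale a x) y.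
Proof.
elim/presented_ind: x => s; elim/presented_ind: y => t.
by rewrite !(pmul_pi, pscale_pi); apply/presentedP/fc_scaleAl.
Qed.

Lemma pscaleAr a (x y : presented) : pscale a (pmul x y) = pmul x (pscale a y).
Proof.
elim/presented_ind: x => s; elim/presented_ind: y => t.
by rewrite !(pmul_pi, pscale_pi); apply/presentedP/fc_scaleAr.
Qed.

HB.instance Definition _ := Lmodule_isNuAlgebra.Build F presented
  pmulA pmulDl pmulDr pscaleAl pscaleAr.

Definition pgen (x : X) : presented := \pi_presented (FGen x).

Lemma presented_pi0 : \pi_presented FZero = 0. Proof. by []. Qed.

Lemma presented_piD s t :
  \pi_presented (FAdd s t) = \pi_presented s + \pi_presented t.
Proof. by rewrite -padd_pi. Qed.

Lemma presented_piZ a t :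
  \pi_presented (FScale a t) = a *: \pi_presented t.
Proof. by rewrite -pscale_pi. Qed.

Lemma presented_piM s t :
  \pi_presented (FMul s t) = \pi_presented s ** \pi_presented t.
Proof. by rewrite -pmul_pi. Qed.

End Presentation.

Arguments FZero {F X}.
Arguments FGen {F X}.

Record digraph : Type := Digraph {
  vertex : Type;
  arrow : Type;
  source : arrow -> vertex;
  target : arrow -> vertex
}.

Section LeavittPathAlgebra.
Variables (F : fieldType) (Gamma : digraph).

Inductive lpa_gen : Type :=
  | GVertex of vertex Gamma
  | GArrow of arrow Gamma
  | GGhost of arrow Gamma.

Local Notation tV v := (@FGen F lpa_gen (GVertex v)).
Local Notation tE e := (@FGen F lpa_gen (GArrow e)).
Local Notation tG e := (@FGen F lpa_gen (GGhost e)).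

(* In [lpa_CK2] the list [es] enumerates the arrows of source [v] without
   repetition: such a nonempty list exists iff 0 < |s^-1(v)| < oo. *)
Inductive lpa_rel : fterm F lpa_gen -> fterm F lpa_gen -> Prop :=
  | lpa_vv v : lpa_rel (FMul (tV v) (tV v)) (tV v)
  | lpa_uv u v : u <> v -> lpa_rel (FMul (tV u) (tV v)) FZero
  | lpa_se e : lpa_rel (FMul (tV (source e)) (tE e)) (tE e)
  | lpa_et e : lpa_rel (FMul (tE e) (tV (target e))) (tE e)
  | lpa_tg e : lpa_rel (FMul (tV (target e)) (tG e)) (tG e)
  | lpa_gs e : lpa_rel (FMul (tG e) (tV (source e))) (tG e)
  | lpa_CK1_eq e : lpa_rel (FMul (tG e) (tE e)) (tV (target e))
  | lpa_CK1_neq e f : e <> f -> lpa_rel (FMul (tG e) (tE f)) FZero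
  | lpa_CK2 v (es : seq (arrow Gamma)) :
      es <> [::] -> List.NoDup es ->
      (forall e, List.In e es <-> source e = v) ->
      lpa_rel (tV v)
        (foldr (fun e t => FAdd (FMul (tE e) (tG e)) t) FZero es).

Definition leavitt := presented lpa_rel.

HB.instance Definition _ := NuAlgebra.on leavitt.

Definition lpa_gdeg (g : lpa_gen) : int :=
  match g with GVertex _ => 0 | GArrow _ => 1 | GGhost _ => -1 end.

(* The component of degree [n] is the span of the products of generators of
   total degree [n]. *)
Inductive lpa_homog : int -> set leavitt :=
  | lpa_homog_gen g : lpa_homog (lpa_gdeg g) (pgen lpa_rel g)
  | lpa_homog0 n : lpa_homog n 0
  | lpa_homogD n x y : lpa_homog n x -> lpa_homog n y -> lpa_homog n (x + y)
  | lpa_homogZ n a x : lpa_homog n x -> lpa_homog n (a *: x)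
  | lpa_homogM m n x y :
      lpa_homog m x -> lpa_homog n y -> lpa_homog (m + n) (x ** y).

(* The sum of the components is direct: [leavitt] acts on the sequences
    [int -> leavitt], with [lpa_homog n] acting by multiplication followed by a
    shift by [n]. *)

Local Notation seqL := (int -> leavitt).

Fixpoint lpa_op (t : fterm F lpa_gen) (w : seqL) : seqL :=
  match t with
  | FGen g => fun k => pgen lpa_rel g ** w (k - lpa_gdeg g)
  | FZero => fun=> 0
  | FAdd s t => fun k => lpa_op s w k + lpa_op t w k
  | FScale a t => fun k => a *: lpa_op t w k
  | FMul s t => lpa_op s (lpa_op t w)
  end.

Lemma lpa_opD t (w w' : seqL) :
  lpa_op t (fun k => w k + w' k) = fun k => lpa_op t w k + lpa_op t w' k.
Proof.
elim: t w w' => [g||s IHs t IHt|a t IHt|s IHs t IHt] w w' /=; last first.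
- by rewrite IHt IHs.
- by rewrite IHt; apply/funext => k; rewrite scalerDr.
- by rewrite IHs IHt; apply/funext => k; rewrite addrACA.
- by apply/funext => k; rewrite addr0.
- by apply/funext => k; rewrite numulDr.
Qed.

Lemma lpa_opZ t a (w : seqL) :
  lpa_op t (fun k => a *: w k) = fun k => a *: lpa_op t w k.
Proof.
elim: t w => [g||s IHs t IHt|b t IHt|s IHs t IHt] w /=; last first.
- by rewrite IHt IHs.
- by rewrite IHt; apply/funext => k; rewrite !scalerA mulrC.
- by rewrite IHs IHt; apply/funext => k; rewrite scalerDr.
- by apply/funext => k; rewrite scaler0.
- by apply/funext => k; rewrite nuscaleAr.
Qed.

Lemma lpa_relE s t : lpa_rel s t ->
  \pi_leavitt s = \pi_leavitt t.
Proof. by move=> st; apply/presentedP/fc_rel. Qed.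

Lemma lpa_op_rel s t : lpa_rel s t -> lpa_op s = lpa_op t.
Proof.
have E2 g h z : pgen lpa_rel g ** (pgen lpa_rel h ** z) =
    \pi_leavitt (FMul (FGen g) (FGen h)) ** z.
  by rewrite presented_piM numulA.
move=> st; apply/funext => w; apply/funext => k; have := lpa_relE st.
case: st k => [v|u v uv|e|e|e|e|e|e f ef|v es _ _ _] k /=;
  rewrite ?E2 ?subr0 => E.
- by rewrite E.
- by rewrite E presented_pi0 numul0r.
- by rewrite E.
- by rewrite E.
- by rewrite E.
- by rewrite E.
- by rewrite E opprK addrK.
- by rewrite E presented_pi0 numul0r.
- rewrite /pgen E => {E}; elim: es => [|e es IHes] /=.
    by rewrite presented_pi0 numul0r.
  by rewrite presented_piD numulDl IHes E2 opprK subrK.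
Qed.

Lemma lpa_op_congr s t : fcongr lpa_rel s t -> lpa_op s = lpa_op t.
Proof.
elim=> {s t} => [s t /lpa_op_rel //|t //|s t _ //|s t u _ -> _ -> //
  |s s' t t' _ /= -> _ -> //|a t t' _ /= -> //|s s' t t' _ /= -> _ -> //
  |s t u|s t|t|t|a b t|t|a s t|a b t|s t u //|s t u //|s t u|a s t //|a s t];
  apply/funext => w; apply/funext => k /=.
- by rewrite addrA.
- by rewrite addrC.
- by rewrite add0r.
- by rewrite scaleN1r addNr.
- by rewrite scalerA.
- by rewrite scale1r.
- by rewrite scalerDr.
- by rewrite scalerDl.
- by rewrite lpa_opD.
- by rewrite lpa_opZ.
Qed.

Definition lpa_act (x : leavitt) : seqL -> seqL := lpa_op (repr x).

Lemma lpa_act_pi t : lpa_act (\pi_leavitt t) = lpa_op t.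
Proof. by apply/lpa_op_congr/repr_pi. Qed.

Lemma lpa_actD x y w k : lpa_act (x + y) w k = lpa_act x w k + lpa_act y w k.
Proof.
elim/presented_ind: x => s; elim/presented_ind: y => t.
by rewrite -presented_piD !lpa_act_pi.
Qed.

Lemma lpa_act0 w k : lpa_act 0 w k = 0.
Proof. by rewrite -presented_pi0 lpa_act_pi. Qed.

Lemma lpa_actZ a x w k : lpa_act (a *: x) w k = a *: lpa_act x w k.
Proof. by elim/presented_ind: x => t; rewrite -presented_piZ !lpa_act_pi. Qed.

Lemma lpa_actM x y w : lpa_act (x ** y) w = lpa_act x (lpa_act y w).
Proof.
elim/presented_ind: x => s; elim/presented_ind: y => t.
by rewrite -presented_piM !lpa_act_pi.
Qed.

Lemma lpa_act_sum (T : Type) (r : seq T) (G : T -> leavitt) w k :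
  lpa_act (\sum_(i <- r) G i) w k = \sum_(i <- r) lpa_act (G i) w k.
Proof.
elim: r => [|i r IHr]; first by rewrite !big_nil lpa_act0.
by rewrite !big_cons lpa_actD IHr.
Qed.

Lemma lpa_act_homog n x w k :
  lpa_homog n x -> lpa_act x w k = x ** w (k - n).
Proof.
move=> nx; elim: nx w k => {n x} [g|n|n x y _ IHx _ IHy|n a x _ IHx
  |m n x y _ IHx _ IHy] w k.
- by rewrite lpa_act_pi.
- by rewrite lpa_act0 numul0r.
- by rewrite lpa_actD IHx IHy numulDl.
- by rewrite lpa_actZ IHx nuscaleAl.
- by rewrite lpa_actM IHx IHy numulA opprD addrA.
Qed.

Local Notation vtx := {classic (vertex Gamma)}.

Definition lpa_vsum (vs : seq vtx) : leavitt :=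
  \sum_(v <- vs) pgen lpa_rel (GVertex v).

Lemma lpa_vsum_homog vs : lpa_homog 0 (lpa_vsum vs).
Proof.
rewrite /lpa_vsum; elim: vs => [|v vs IHvs].
  by rewrite big_nil; apply: lpa_homog0.
by rewrite big_cons; apply/lpa_homogD/IHvs/(lpa_homog_gen (GVertex v)).
Qed.

Lemma lpa_vertexM (u v : vtx) :
  pgen lpa_rel (GVertex u) ** pgen lpa_rel (GVertex v) =
  if v == u then pgen lpa_rel (GVertex v) else 0.
Proof.
rewrite /pgen -presented_piM; case: eqP => [->|uv].
  exact/lpa_relE/lpa_vv.
by rewrite -presented_pi0; apply/lpa_relE/lpa_uv => /esym.
Qed.

Lemma lpa_vsum_unit (v : vtx) vs : uniq vs -> v \in vs ->
  pgen lpa_rel (GVertex v) ** lpa_vsum vs = pgen lpa_rel (GVertex v).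
Proof.
move=> uvs vvs; rewrite /lpa_vsum (bigD1_seq v) //= numulDr lpa_vertexM eqxx.
rewrite -[RHS]addr0; congr (_ + _).
elim: (vs) => [|u us IHus]; first by rewrite big_nil numulr0.
by rewrite big_cons; case: ifP => //= /negPf uv; rewrite numulDr lpa_vertexM uv add0r.
Qed.

Lemma lpa_local_unit (x : leavitt) :
  exists us : seq vtx, forall vs, uniq vs -> {subset us <= vs} ->
    x ** lpa_vsum vs = x.
Proof.
elim/presented_ind: x => t.
elim: t => [g||s [us IHs] t [ws IHt]|a t [us IHt]|s [us IHs] t [ws IHt]].
- have [v gv] : exists v : vtx,
      \pi_leavitt (FGen g) = \pi_leavitt (FGen g) ** pgen lpa_rel (GVertex v).
    case: g => [v|e|e]; [exists v|exists (target e)|exists (source e)];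
      rewrite -presented_piM; apply/esym/lpa_relE; by constructor.
  exists [:: v] => vs uvs vvs.
  by rewrite gv -numulA lpa_vsum_unit// vvs ?mem_head.
- by exists [::] => vs _ _; rewrite presented_pi0 numul0r.
- exists (us ++ ws) => vs uvs sub; rewrite presented_piD numulDl IHs ?IHt //.
  + by move=> v vws; apply: sub; rewrite mem_cat vws orbT.
  + by move=> v vus; apply: sub; rewrite mem_cat vus.
- by exists us => vs uvs sub; rewrite presented_piZ -nuscaleAl IHt.
- by exists ws => vs uvs sub; rewrite presented_piM -numulA IHt.
Qed.

Lemma lpa_graded_ideal_proj (I : set leavitt) (s : seq (int * leavitt)) u d :
  is_graded_ideal lpa_homog I ->
  (forall p, p \in s -> lpa_homog p.1 p.2) -> I (\sum_(p <- s) p.2) ->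
  I (\sum_(p <- s | p.1 == d) p.2 ** u).
Proof.
move=> gI hs Is; pose w : seqL := fun k => if k == 0 then u else 0.
have actE (r : seq (int * leavitt)) :
    (forall p, p \in r -> lpa_homog p.1 p.2) ->
    lpa_act (\sum_(p <- r) p.2) w d = \sum_(p <- r | p.1 == d) p.2 ** u.
  move=> hr; rewrite lpa_act_sum [RHS]big_mkcond /= !big_seq.
  apply: eq_bigr => p pr; rewrite (lpa_act_homog w d (hr p pr)) /w subr_eq0 eq_sym.
  by case: eqP => // _; rewrite numulr0.
have [[I0 ID IZ IM] IG] := gI; rewrite -actE //.
have [r [hr ->]] := IG _ Is; rewrite actE => [|p /hr[]//].
rewrite big_seq_cond; apply: big_ind => // p /andP[/hr[_ Ip] _].
by have [] := IM _ u Ip.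
Qed.

Lemma lpa_graded_idealI (I J : set leavitt) :
  is_graded_ideal lpa_homog I -> is_graded_ideal lpa_homog J ->
  is_graded_ideal lpa_homog (I `&` J).
Proof.
move=> gI gJ; split.
  have [[I0 ID IZ IM] _] := gI; have [[J0 JD JZ JM] _] := gJ; split.
  - by [].
  - by move=> x y [Ix Jx] [Iy Jy]; split; [apply: ID|apply: JD].
  - by move=> a x [Ix Jx]; split; [apply: IZ|apply: JZ].
  - move=> x y [/(IM _ y)[Il Ir] /(JM _ y)[Jl Jr]].
    by split; split.
move=> x [Ix Jx]; have [us /(_ (undup us))] := lpa_local_unit x.
move=> /(_ (undup_uniq _)) xu; set u := lpa_vsum _ in xu.
have {}xu : x ** u = x by apply: xu => v; rewrite mem_undup.
have [r [hr xE]] := gI.2 _ Ix.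
have hr1 p : p \in r -> lpa_homog p.1 p.2 by move=> /hr[].
pose c d : leavitt := \sum_(p <- r | p.1 == d) p.2 ** u.
pose ds := undup [seq p.1 | p <- r].
exists [seq (d, c d) | d <- ds]; split.
  move=> _ /mapP[d _ ->] /=; split; last first.
    by split; apply: lpa_graded_ideal_proj => //; rewrite -xE.
  rewrite /c big_seq_cond; apply: big_ind.
  - exact: lpa_homog0.
  - by move=> y z; apply: lpa_homogD.
  - move=> p /andP[/hr1 hp /eqP <-]; rewrite -[p.1]addr0.
    exact/lpa_homogM/lpa_vsum_homog.
rewrite big_map /= -[LHS]xu [in LHS]xE numul_suml /c.
under [RHS]eq_bigr do rewrite big_mkcond /=.
rewrite exchange_big /= !big_seq; apply: eq_bigr => p pr.
rewrite -big_mkcond /= (eq_bigl (xpred1 p.1)) => [|d]; last by rewrite eq_sym.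
rewrite -big_filter filter_pred1_uniq ?undup_uniq ?big_seq1 //.
by rewrite mem_undup map_f.
Qed.

Definition ideal_sum (I J : set leavitt) : set leavitt :=
  [set x + y | x in I & y in J].

Lemma lpa_graded_ideal_sum (I J : set leavitt) :
  is_graded_ideal lpa_homog I -> is_graded_ideal lpa_homog J ->
  is_graded_ideal lpa_homog (ideal_sum I J).
Proof.
move=> [[I0 ID IZ IM] IG] [[J0 JD JZ JM] JG]; split; first split.
- by exists 0 => //; exists 0 => //; rewrite addr0.
- move=> _ _ [x Ix [y Jy <-]] [x' Ix' [y' Jy' <-]].
  exists (x + x'); first exact: ID.
  by exists (y + y'); [exact: JD|rewrite addrACA].
- move=> a _ [x Ix [y Jy <-]]; exists (a *: x); first exact: IZ.
  by exists (a *: y); [exact: JZ|rewrite scalerDr].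
- move=> _ z [x Ix [y Jy <-]].
  have [Il Ir] := IM _ z Ix; have [Jl Jr] := JM _ z Jy; split.
    by exists (z ** x) => //; exists (z ** y) => //; rewrite numulDr.
  by exists (x ** z) => //; exists (y ** z) => //; rewrite numulDl.
move=> _ [x Ix [y Jy <-]].
have [r [hr ->]] := IG _ Ix; have [s [hs ->]] := JG _ Jy.
exists (r ++ s); split; last by rewrite big_cat.
move=> p; rewrite mem_cat => /orP[/hr|/hs] [hp Hp]; split=> //.
  by exists p.2 => //; exists 0 => //; rewrite addr0.
by exists 0 => //; exists p.2 => //; rewrite add0r.
Qed.

Record graded_ideal : Type := GradedIdeal {
  graded_ideal_set :> set leavitt;
  graded_idealP : is_graded_ideal lpa_homog graded_ideal_set
}.

HB.instance Definition _ := gen_eqMixin graded_ideal.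
HB.instance Definition _ := gen_choiceMixin graded_ideal.

Lemma graded_ideal_inj (I J : graded_ideal) : I = J :> set leavitt -> I = J.
Proof.
case: I J => [I gI] [J gJ] /= IJ; move: gI; rewrite IJ => gI.
by rewrite (Prop_irrelevance gI gJ).
Qed.

Definition graded_ideal_le (I J : graded_ideal) : bool := `[< (I `<=` J)%classic >].

Definition graded_ideal_meet (I J : graded_ideal) : graded_ideal :=
  GradedIdeal (lpa_graded_idealI (graded_idealP I) (graded_idealP J)).

Definition graded_ideal_join (I J : graded_ideal) : graded_ideal :=
  GradedIdeal (lpa_graded_ideal_sum (graded_idealP I) (graded_idealP J)).

Fact graded_ideal_display : Order.disp_t. Proof. exact: Order.Disp tt tt. Qed.

Lemma graded_ideal_le_refl : reflexive graded_ideal_le.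
Proof. by move=> I; apply/asboolP. Qed.

Lemma graded_ideal_le_anti : antisymmetric graded_ideal_le.
Proof.
move=> I J /andP[/asboolP IJ /asboolP JI].
by apply: graded_ideal_inj; apply/seteqP.
Qed.

Lemma graded_ideal_le_trans : transitive graded_ideal_le.
Proof.
by move=> J I K /asboolP IJ /asboolP JK; apply/asboolP => x /IJ /JK.
Qed.

HB.instance Definition _ := Order.Le_isPOrder.Build graded_ideal_display
  graded_ideal graded_ideal_le_refl graded_ideal_le_anti graded_ideal_le_trans.

Lemma graded_ideal_meetP (I J K : graded_ideal) :
  (I <= graded_ideal_meet J K)%O = (I <= J)%O && (I <= K)%O.
Proof.
apply/asboolP/andP => [IJK|[/asboolP IJ /asboolP IK] x Ix].
  by split; apply/asboolP => x /IJK[].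
by split; [apply: IJ|apply: IK].
Qed.

Lemma graded_ideal_joinP (I J K : graded_ideal) :
  (graded_ideal_join I J <= K)%O = (I <= K)%O && (J <= K)%O.
Proof.
have [[I0 _ _ _] _] := graded_idealP I; have [[J0 _ _ _] _] := graded_idealP J.
have [[_ KD _ _] _] := graded_idealP K.
apply/asboolP/andP => [IJK|[/asboolP IK /asboolP JK] _ [x Ix [y Jy <-]]].
  split; apply/asboolP => x Hx; apply: IJK.
    by exists x => //; exists 0 => //; rewrite addr0.
  by exists 0 => //; exists x => //; rewrite add0r.
by apply: KD; [apply: IK|apply: JK].
Qed.

HB.instance Definition _ := Order.POrder_MeetJoin_isLattice.Build
  graded_ideal_display graded_ideal graded_ideal_meetP graded_ideal_joinP.

End LeavittPathAlgebra.

Definition lattice_isomorphic (d d' : Order.disp_t)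
    (L : latticeType d) (L' : latticeType d') : Prop :=
  exists f : L -> L',
    [/\ bijective f,
        {morph f : x y / (x `&` y)%O >-> (x `&` y)%O}
      & {morph f : x y / (x `|` y)%O >-> (x `|` y)%O}].

Record category : Type := Category {
  cat_obj :> Type;
  cat_hom : cat_obj -> cat_obj -> Type;
  cat_id : forall a, cat_hom a a;
  cat_comp : forall a b c, cat_hom b c -> cat_hom a b -> cat_hom a c;
  cat_comp1f : forall a b (f : cat_hom a b), cat_comp (cat_id b) f = f;
  cat_compf1 : forall a b (f : cat_hom a b), cat_comp f (cat_id a) = f;
  cat_compA : forall a b c d
      (h : cat_hom c d) (g : cat_hom b c) (f : cat_hom a b),
    cat_comp h (cat_comp g f) = cat_comp (cat_comp h g) f
}.

Record functor (C D : category) : Type := Functor {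
  fun_obj :> C -> D;
  fun_hom : forall a b, cat_hom a b -> cat_hom (fun_obj a) (fun_obj b);
  fun_hom1 : forall a, fun_hom (cat_id a) = cat_id (fun_obj a);
  fun_homM : forall a b c (g : cat_hom b c) (f : cat_hom a b),
    fun_hom (cat_comp g f) = cat_comp (fun_hom g) (fun_hom f)
}.

Definition functor_id (C : category) : functor C C :=
  @Functor C C (fun a => a) (fun _ _ f => f)
    (fun _ => erefl) (fun _ _ _ _ _ => erefl).

Section FunctorComp.
Variables (C D E : category) (G : functor D E) (H : functor C D).

Lemma functor_comp_hom1 a :
  fun_hom G (fun_hom H (cat_id a)) = cat_id (G (H a)).
Proof. by rewrite !fun_hom1. Qed.

Lemma functor_comp_homM a b c (g : cat_hom b c) (f : cat_hom a b) :
  fun_hom G (fun_hom H (cat_comp g f)) =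
  cat_comp (fun_hom G (fun_hom H g)) (fun_hom G (fun_hom H f)).
Proof. by rewrite !fun_homM. Qed.

Definition functor_comp : functor C E :=
  @Functor C E (fun a => G (H a)) (fun _ _ f => fun_hom G (fun_hom H f))
    functor_comp_hom1 functor_comp_homM.

End FunctorComp.

Definition naturally_isomorphic (C D : category) (G H : functor C D) : Prop :=
  exists (eta : forall a, cat_hom (G a) (H a))
         (eps : forall a, cat_hom (H a) (G a)),
    [/\ forall a b (f : cat_hom a b),
          cat_comp (eta b) (fun_hom G f) = cat_comp (fun_hom H f) (eta a),
        forall a, cat_comp (eps a) (eta a) = cat_id (G a)
      & forall a, cat_comp (eta a) (eps a) = cat_id (H a)].

Definition equivalent_categories (C D : category) : Prop :=
  exists (G : functor C D) (H : functor D C),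
    naturally_isomorphic (functor_comp H G) (functor_id C) /\
    naturally_isomorphic (functor_comp G H) (functor_id D).

Section UnitalModules.
Variables (F : fieldType) (A : nuAlgType F).

(* Only the ring structure of [A] acts. When [A] has local units, the relation
   M = MA endows [M] with a unique compatible F-vector space structure, which
   every A-linear map preserves. *)
Record unital_module : Type := UnitalModule {
  um_sort :> zmodType;
  um_act : um_sort -> A -> um_sort;
  um_actDl : forall m n a, um_act (m + n) a = um_act m a + um_act n a;
  um_actDr : forall m a b, um_act m (a + b) = um_act m a + um_act m b;
  um_actA : forall m a b, um_act (um_act m a) b = um_act m (a ** b);
  um_unital : forall m, exists s : seq (um_sort * A),
    m = \sum_(p <- s) um_act p.1 p.2
}.

Record module_hom (M N : unital_module) : Type := ModuleHom {
  mh_fun :> M -> N;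
  mh_additive : {morph mh_fun : x y / x + y};
  mh_linear : forall m a, mh_fun (um_act m a) = um_act (mh_fun m) a
}.

Lemma module_hom_inj M N (f g : module_hom M N) : f =1 g -> f = g.
Proof.
case: f g => [f fD fL] [g gD gL] /= /funext fg.
move: fD fL; rewrite fg => fD fL.
by rewrite (Prop_irrelevance fD gD) (Prop_irrelevance fL gL).
Qed.

Definition module_hom_id M : module_hom M M :=
  @ModuleHom M M id (fun _ _ => erefl) (fun _ _ => erefl).

Section HomComp.
Variables (M N P : unital_module) (g : module_hom N P) (f : module_hom M N).

Lemma module_hom_comp_additive : {morph (g \o f) : x y / x + y}.
Proof. by move=> x y; rewrite /= !mh_additive. Qed.

Lemma module_hom_comp_linear m a : (g \o f) (um_act m a) = um_act ((g \o f) m) a.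
Proof. by rewrite /= !mh_linear. Qed.

Definition module_hom_comp : module_hom M P :=
  ModuleHom module_hom_comp_additive module_hom_comp_linear.

End HomComp.

Lemma module_hom_comp1f M N (f : module_hom M N) :
  module_hom_comp (module_hom_id N) f = f.
Proof. exact: module_hom_inj. Qed.

Lemma module_hom_compf1 M N (f : module_hom M N) :
  module_hom_comp f (module_hom_id M) = f.
Proof. exact: module_hom_inj. Qed.

Lemma module_hom_compA M N P Q (h : module_hom P Q) (g : module_hom N P)
    (f : module_hom M N) :
  module_hom_comp h (module_hom_comp g f) =
  module_hom_comp (module_hom_comp h g) f.
Proof. exact: module_hom_inj. Qed.

Definition unital_modules : category :=
  Category module_hom_comp1f module_hom_compf1 module_hom_compA.

End UnitalModules.

Definition morita_equivalent (F : fieldType) (A B : nuAlgType F) : Prop :=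
  equivalent_categories (unital_modules A) (unital_modules B).

(* Main.v *)
(* An ideal of a Leavitt path algebra is graded if and only if it is idempotent,
   and idempotency of ideals is visible in the module category.

   Idempotent ideals of any Z-graded algebra with local units are graded: let
   the algebra act on sequences [w : Z -> L] by convolution. If the differences
   of [w] of order [j + 1] vanish modulo [I], an element of [I] lowers this order
   by one, so that [I = I^j] sends the polynomial sequences into [I]. Binomial
   sequences then isolate the extreme components of an element of [I].

   Conversely let [x] be a homogeneous element of a graded ideal [I], a
   combination of monomials [p v q^*] whose arrows lie in a finite set [T]. Put
   [g = v - sum_(e in T, s(e) = v) e e^*]. If [p] is of minimal length then
   [g p^* x q] is the multiple [c g] of the idempotent [g], where [c] is the
   coefficient of [p v q^*]; hence [c p g q^*] is in [I^2], and modulo this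
   element [p v q^*] is a combination of longer monomials over [T].

   Finally, for an equivalence [H] from B-modules to A-modules, send an ideal
   [I] of A to the annihilator [J] of the B-modules [N] such that [H N] is
   killed by [I]. This class of modules is stable under jointly monic and jointly
   epic families, contains [B / J] as it is cogenerated by the class, hence
   consists of all the modules killed by [J]. Idempotency of [I] means that the
   modules killed by [I] are closed under extensions. *)
From HB Require Import structures.
Require Import Defs.
From mathcomp Require Import all_boot all_order all_algebra.
From mathcomp Require Import ring.
From mathcomp Require Import boolp classical_sets.

Set Implicit Arguments.
Unset Strict Implicit.
Unset Printing Implicit Defensive.

Import Order.TTheory GRing.Theory Num.Theory.
Local Open Scope ring_scope.
Local Open Scope quotient_scope.

Local Notation "x ** y" := (numul x y) (at level 40, left associativity).

(** * Ideals and unital modules *)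

Section NuAlgebraIdeals.
Variables (F : fieldType) (A : nuAlgType F).

Lemma numulrN (x y : A) : x ** (- y) = - (x ** y).
Proof. by rewrite -!scaleN1r nuscaleAr. Qed.

Lemma numulNr (x y : A) : (- x) ** y = - (x ** y).
Proof. by rewrite -!scaleN1r nuscaleAl. Qed.

Lemma numul_sumr (x : A) (T : Type) (s : seq T) (P : pred T) (G : T -> A) :
  x ** (\sum_(i <- s | P i) G i) = \sum_(i <- s | P i) x ** G i.
Proof.
elim: s => [|i s IHs]; first by rewrite !big_nil numulr0.
by rewrite !big_cons; case: ifP => _; rewrite ?numulDr IHs.
Qed.

Lemma numul_suml_cond (x : A) (T : Type) (s : seq T) (P : pred T) (G : T -> A) :
  (\sum_(i <- s | P i) G i) ** x = \sum_(i <- s | P i) G i ** x.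
Proof. by rewrite -big_filter numul_suml big_filter. Qed.

(* [I = I^2]: the ideal [I^2] is the least [K] containing the products. *)
Definition idempotent_ideal (I : set A) : Prop :=
  is_ideal I /\ forall K : set A, is_ideal K ->
    (forall x y, I x -> I y -> K (x ** y)) -> (I `<=` K)%classic.

Lemma idealN (I : set A) x : is_ideal I -> I x -> I (- x).
Proof. by move=> [_ _ IZ _] Ix; rewrite -scaleN1r; apply: IZ. Qed.

Lemma ideal_sum_seq (I : set A) (T : eqType) (s : seq T) (G : T -> A)
    (P : pred T) :
  is_ideal I -> (forall i, i \in s -> P i -> I (G i)) ->
  I (\sum_(i <- s | P i) G i).
Proof.
move=> [I0 ID _ _] IG; rewrite big_seq_cond; apply: big_ind => // i /andP[].
exact: IG.
Qed.

(** The unit is common to a finite family because an element of a unital module is a finite sum of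
    products; on the left, one element at a time is treated. *)
Definition right_local_units : Prop :=
  forall s : seq A, exists u, forall x, x \in s -> x ** u = x.

Definition left_units : Prop := forall x : A, exists u, u ** x = x.

End NuAlgebraIdeals.

(** * Quotients of unital modules *)

Section QuotientModule.
Variables (F : fieldType) (A : nuAlgType F) (M : unital_module A).

Lemma um_act0 (a : A) : um_act (0 : M) a = 0.
Proof. by apply: (addIr (um_act 0 a)); rewrite -um_actDl !add0r. Qed.

Lemma um_actr0 (m : M) : um_act m 0 = 0.
Proof. by apply: (addIr (um_act m 0)); rewrite -um_actDr !add0r. Qed.

Lemma um_actN (m : M) (a : A) : um_act (- m) a = - um_act m a.
Proof. by apply/eqP; rewrite -addr_eq0 -um_actDl addNr um_act0. Qed.

Lemma um_act_sum (s : seq (M * A)) (a : A) :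
  um_act (\sum_(p <- s) um_act p.1 p.2) a = \sum_(p <- s) um_act p.1 (p.2 ** a).
Proof.
elim: s => [|p s IHs]; first by rewrite !big_nil um_act0.
by rewrite !big_cons um_actDl um_actA IHs.
Qed.

Lemma mh0 (N : unital_module A) (f : module_hom M N) : f 0 = 0.
Proof. by apply: (addIr (f 0)); rewrite -mh_additive !add0r. Qed.

Lemma mhB (N : unital_module A) (f : module_hom M N) m n : f (m - n) = f m - f n.
Proof. by apply: (addIr (f n)); rewrite -mh_additive !subrK. Qed.

Definition is_submodule (S : set M) : Prop :=
  [/\ S 0, forall m n, S m -> S n -> S (m - n)
    & forall m (a : A), S m -> S (um_act m a)].

Record submodule : Type := Submodule {
  submodule_set :> M -> Prop;
  submoduleP : is_submodule submodule_set
}.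

Variable S : submodule.

Definition submodule_pred : pred M := fun m => `[< S m >].

Lemma submodule_pred_closed : zmod_closed submodule_pred.
Proof.
have [S0 SB _] := submoduleP S; split; first exact/asboolP.
by move=> m n /asboolP Sm /asboolP Sn; apply/asboolP/SB.
Qed.

HB.instance Definition _ :=
  GRing.isZmodClosed.Build M submodule_pred submodule_pred_closed.

Definition submodule_zmod : zmodClosed M :=
  GRing.ZmodClosed.clone _ submodule_pred _.
Local Notation Q := {ideal_quot submodule_zmod}.

Lemma quotient_piP (m n : M) : \pi_Q m = \pi_Q n <-> S (m - n).
Proof.
have mnE := Quotient.idealrBE submodule_zmod m n.
split=> [mn|Smn].
  by apply/asboolP; have: m - n \in submodule_zmod by rewrite mnE mn.
by apply/eqP; rewrite -mnE; exact/asboolP.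
Qed.

Definition quotient_act (q : Q) (a : A) : Q := \pi_Q (um_act (repr q) a).

Lemma quotient_act_pi m a : quotient_act (\pi_Q m) a = \pi_Q (um_act m a).
Proof.
have [_ _ SL] := submoduleP S.
apply/quotient_piP; rewrite -um_actN -um_actDl; apply/SL/quotient_piP.
by rewrite reprK.
Qed.

Lemma quotient_actDl p q a :
  quotient_act (p + q) a = quotient_act p a + quotient_act q a.
Proof.
elim/quotW: p => m; elim/quotW: q => n.
by rewrite -raddfD !quotient_act_pi um_actDl raddfD.
Qed.

Lemma quotient_actDr q a b :
  quotient_act q (a + b) = quotient_act q a + quotient_act q b.
Proof. by elim/quotW: q => m; rewrite !quotient_act_pi um_actDr raddfD. Qed.

Lemma quotient_actA q a b :
  quotient_act (quotient_act q a) b = quotient_act q (a ** b).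
Proof.
by elim/quotW: q => m; rewrite !(quotient_act_pi m) quotient_act_pi um_actA.
Qed.

Lemma quotient_unital q : exists s : seq (Q * A),
  q = \sum_(p <- s) quotient_act p.1 p.2.
Proof.
have [s ms] := um_unital (repr q).
exists [seq (\pi_Q p.1, p.2) | p <- s].
rewrite -[LHS]reprK ms raddf_sum big_map.
by apply: eq_bigr => p _; rewrite quotient_act_pi.
Qed.

Definition quotient_module : unital_module A :=
  UnitalModule quotient_actDl quotient_actDr quotient_actA quotient_unital.

Definition quotient_map : module_hom M quotient_module :=
  @ModuleHom _ _ M quotient_module \pi_Q (raddfD _)
    (fun m a => esym (quotient_act_pi m a)).

Lemma quotient_map_surj (q : quotient_module) : exists m, q = quotient_map m.
Proof. by exists (repr (q : Q)); rewrite /= reprK. Qed.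

Lemma quotient_mapP (m n : M) :
  quotient_map m = quotient_map n <-> S (m - n).
Proof. exact: quotient_piP. Qed.

Section Lift.
Variables (N : unital_module A) (f : module_hom M N).
Hypothesis fS : forall m, S m -> f m = 0.

Definition quotient_lift_fun (q : quotient_module) : N := f (repr (q : Q)).

Lemma quotient_lift_pi m : quotient_lift_fun (quotient_map m) = f m.
Proof.
apply/eqP; rewrite -subr_eq0 -mhB; apply/eqP/fS/quotient_piP.
by rewrite reprK.
Qed.

Lemma quotient_lift_additive : {morph quotient_lift_fun : x y / x + y}.
Proof.
move=> p q; have [m ->] := quotient_map_surj p; have [n ->] := quotient_map_surj q.
by rewrite -mh_additive !quotient_lift_pi mh_additive.
Qed.

Lemma quotient_lift_linear q a :
  quotient_lift_fun (um_act q a) = um_act (quotient_lift_fun q) a.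
Proof.
have [m ->] := quotient_map_surj q.
by rewrite -mh_linear !quotient_lift_pi mh_linear.
Qed.

Definition quotient_lift : module_hom quotient_module N :=
  ModuleHom quotient_lift_additive quotient_lift_linear.

Lemma quotient_liftE m : quotient_lift (quotient_map m) = f m.
Proof. exact: quotient_lift_pi. Qed.

End Lift.

End QuotientModule.

Section ModuleHoms.
Variables (F : fieldType) (A : nuAlgType F).
Hypothesis unitsA : right_local_units A.
Implicit Types (M N : unital_module A) (I : set A).

Lemma um_act_unit M (m : M) : exists u : A, um_act m u = m.
Proof.
have [s ms] := um_unital m; have [u us] := unitsA [seq p.2 | p <- s].
exists u; rewrite ms um_act_sum !big_seq.
by apply: eq_bigr => p sp; rewrite us //; apply: map_f.
Qed.

Lemma um_act_eq0 M (m : M) : (forall a : A, um_act m a = 0) -> m = 0.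
Proof. by move=> m0; have [u <-] := um_act_unit m. Qed.

Lemma regular_unital (x : A) : exists s : seq (A * A),
  x = \sum_(p <- s) p.1 ** p.2.
Proof.
have [u xu] := unitsA [:: x]; exists [:: (x, u)].
by rewrite big_seq1 xu ?mem_head.
Qed.

Definition regular_module : unital_module A :=
  @UnitalModule F A A (@numul F A) (@numulDl F A) (@numulDr F A)
    (fun x y z => esym (numulA x y z)) regular_unital.

Definition orbit_map M (m : M) : module_hom regular_module M :=
  @ModuleHom F A regular_module M (um_act m) (um_actDr m)
    (fun a b => esym (um_actA m a b)).

Definition zero_hom M N : module_hom M N :=
  @ModuleHom F A M N (fun=> 0) (fun _ _ => esym (addr0 _))
    (fun _ a => esym (um_act0 N a)).

Lemma hom_kernel_closed M N (f : module_hom M N) :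
  is_submodule (fun m => f m = 0).
Proof.
split=> [|m n fm fn|m a fm]; first exact: mh0.
  by rewrite mhB fm fn subr0.
by rewrite mh_linear fm um_act0.
Qed.

Definition hom_kernel M N (f : module_hom M N) : submodule M :=
  Submodule (hom_kernel_closed f).

Definition annihilates M I : Prop := forall (m : M) x, I x -> um_act m x = 0.

Lemma annihilated_closed M I : is_ideal I ->
  is_submodule (fun m : M => forall x, I x -> um_act m x = 0).
Proof.
move=> [_ _ _ IM]; split=> [x _|m n Sm Sn x Ix|m a Sm x Ix].
- exact: um_act0.
- by rewrite um_actDl um_actN Sm // Sn // subr0.
- by rewrite um_actA Sm //; case: (IM x a Ix).
Qed.

Definition annihilated M I (idI : is_ideal I) : submodule M :=
  Submodule (annihilated_closed M idI).

Lemma ideal_submodule_closed I : is_ideal I ->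
  @is_submodule F A regular_module I.
Proof.
move=> idI; have [I0 ID IZ IM] := idI; split=> // [m n Im In|m a Im].
  by apply: ID => //; apply: idealN.
by case: (IM m a Im).
Qed.

Definition ideal_submodule I (idI : is_ideal I) : submodule regular_module :=
  Submodule (ideal_submodule_closed idI).

End ModuleHoms.

(** * Faithful, full and dense functors *)

Section EquivalenceFunctors.
Variables C D : category.

Definition faithful_functor (G : functor C D) : Prop :=
  forall a b (f g : cat_hom a b), fun_hom G f = fun_hom G g -> f = g.

Definition full_functor (G : functor C D) : Prop :=
  forall a b (f : cat_hom (G a) (G b)), exists g, fun_hom G g = f.

Definition dense_functor (G : functor C D) : Prop :=
  forall d, exists a (f : cat_hom d (G a)) (g : cat_hom (G a) d),
    cat_comp f g = cat_id _ /\ cat_comp g f = cat_id _.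

(** Conjugating [H (G h)] by the natural isomorphism gives back [h]. *)
Lemma retract_faithful (G : functor C D) (H : functor D C) :
  naturally_isomorphic (functor_comp H G) (functor_id C) -> faithful_functor G.
Proof.
move=> [eta [eps [nat _ ee]]] a b f g fg.
have fE h : h = cat_comp (cat_comp (eta b) (fun_hom (functor_comp H G) h)) (eps a).
  by rewrite nat -cat_compA ee cat_compf1.
by rewrite (fE f) (fE g) /= fg.
Qed.

Lemma section_dense (G : functor C D) (H : functor D C) :
  naturally_isomorphic (functor_comp G H) (functor_id D) -> dense_functor G.
Proof.
move=> [eta [eps [_ ee ee']]] d; exists (H d), (eps d), (eta d).
by split; [exact: ee|exact: ee'].
Qed.

End EquivalenceFunctors.

(** The preimage of [f] is the conjugate of [H f] by the natural isomorphism. As [H] is faithful, it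
    is enough to compare after applying [H], where the invertible [eta b] cancels. *)
Lemma equivalence_full (C D : category) (G : functor C D) (H : functor D C) :
  naturally_isomorphic (functor_comp H G) (functor_id C) ->
  naturally_isomorphic (functor_comp G H) (functor_id D) -> full_functor G.
Proof.
move=> HG /retract_faithful Hfaithful a b f; have [eta [eps [nat ee ee']]] := HG.
exists (cat_comp (cat_comp (eta b) (fun_hom H f)) (eps a)); apply: Hfaithful.
set g := cat_comp _ _.
have gE : cat_comp (eta b) (fun_hom (functor_comp H G) g) =
    cat_comp (eta b) (fun_hom H f).
  by rewrite nat -cat_compA ee cat_compf1.
by rewrite -[LHS]cat_comp1f -[RHS]cat_comp1f -!ee -!cat_compA; congr cat_comp.
Qed.

(** * Transport of ideals along an equivalence *)

Section Transport.
Variables (F : fieldType) (A B : nuAlgType F).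
Hypotheses (unitsA : right_local_units A) (unitsB : right_local_units B).
Hypothesis leftB : left_units B.
Variable K : functor (unital_modules B) (unital_modules A).

Hypotheses (Kfaithful : faithful_functor K) (Kfull : full_functor K).
Hypothesis Kdense : dense_functor K.

Definition Kmod (M : unital_module B) : unital_module A := K M.

Definition Khom (M N : unital_module B) (f : module_hom M N) :
    module_hom (Kmod M) (Kmod N) :=
  @fun_hom _ _ K M N f.

Lemma Khom_comp M N P (g : module_hom N P) (f : module_hom M N) m :
  Khom (module_hom_comp g f) m = Khom g (Khom f m).
Proof.
have E : Khom (module_hom_comp g f) = module_hom_comp (Khom g) (Khom f).
  exact: (@fun_homM _ _ K M N P g f).
by rewrite E.
Qed.

Lemma Khom_full M N (f : module_hom (Kmod M) (Kmod N)) :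
  exists g : module_hom M N, Khom g = f.
Proof. exact: Kfull. Qed.

(** Additivity of [K] is not assumed. Fullness gives [g] with [Khom g] zero, and the zero map
    absorbs [g], so its image under [K] factors through 0. *)
Lemma Khom_zero M N m : Khom (zero_hom M N) m = 0.
Proof.
have [g gE] := Khom_full (zero_hom (Kmod M) (Kmod M)).
have : module_hom_comp (zero_hom M N) g = zero_hom M N by exact: module_hom_inj.
move=> /(congr1 (fun h => Khom h m)); rewrite Khom_comp gE /= => <-.
exact: mh0.
Qed.

Lemma Khom_eq0 M N (f : module_hom M N) :
  (forall m, Khom f m = 0) -> forall m, f m = 0.
Proof.
move=> f0 m; suff -> : f = zero_hom M N by [].
apply: Kfaithful; apply: module_hom_inj => k.
by rewrite -[LHS]/(Khom f k) f0; apply/esym/Khom_zero.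
Qed.

Lemma Khom_dense (M : unital_module A) : exists N (f : module_hom M (Kmod N))
  (g : module_hom (Kmod N) M), cancel f g /\ cancel g f.
Proof.
have [N [f [g [fg gf]]]] := Kdense M; exists N, f, g; split=> m.
  exact: (congr1 (fun h : module_hom M M => h m) gf).
exact: (congr1 (fun h : module_hom (Kmod N) (Kmod N) => h m) fg).
Qed.

(* Elements of [K N] do not come from [N], but the submodules they generate are
   images of maps [Khom g]. *)
Lemma orbit_transport (N : unital_module B) (m : Kmod N) :
  exists (P : unital_module B) (g : module_hom P N),
  (forall k, exists a, Khom g k = um_act m a) /\
  (forall a, exists k, Khom g k = um_act m a).
Proof.
have [P [f [g [fg gf]]]] := Khom_dense (regular_module unitsA).
have [h hE] := Khom_full (module_hom_comp (orbit_map unitsA m) g).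
exists P, h; rewrite hE; split=> [k|a]; first by exists (g k).
by exists (f a); rewrite /= fg.
Qed.

Implicit Types (I : set A) (N : unital_module B).

Definition in_transport I (N : unital_module B) : Prop :=
  annihilates (Kmod N) I.

Definition transport I : set B := fun b =>
  forall N, in_transport I N -> forall n : N, um_act n b = 0.

Lemma transport_ideal I : is_ideal (transport I).
Proof.
split=> [N _ n|x y Jx Jy N DN n|c x Jx N DN n|x y Jx].
- exact: um_actr0.
- by rewrite um_actDr (Jx N) // (Jy N) // addr0.
(* Modules carry no scalar action, so [c *: x] is rewritten as [x ** (c *: u)] with [u] a right unit
   of [x]. *)
- have [u ux] := unitsB [:: x].
  by rewrite -(ux x) ?mem_head // nuscaleAr -um_actA (Jx N) // um_act0.
- by split=> N DN n; rewrite -um_actA (Jx N) // um_act0.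
Qed.

(** For [x] in [I], the submodule generated by [m x] is the image of some [Khom g]. Every map to a
    module of the class kills it, since [I] kills the target; hence these maps kill the image of
    [g], so [g] is zero. *)
Lemma in_transport_cogenerated I N :
  (forall n : N,
    (forall N' (f : module_hom N N'), in_transport I N' -> f n = 0) -> n = 0) -> in_transport I N.
Proof.
move=> cogN m x Ix; apply: (um_act_eq0 unitsA) => a.
have [P [g [gm mg]]] := orbit_transport (um_act m x).
have [k <-] := mg a; suff g0 p : g p = 0.
  have -> : g = zero_hom P N by apply: module_hom_inj.
  exact: Khom_zero.
apply: cogN => N' f DN'; move: p; apply: (Khom_eq0 (f := module_hom_comp f g)) => q.
rewrite Khom_comp; have [b ->] := gm q.
by rewrite 2!mh_linear (DN' _ x) // um_act0.
Qed.

(** The quotient [q] of [Kmod N] by the part killed by [I] is, up to isomorphism, [Khom h] for some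
    [h] on [N]. Maps from modules of the class land in the kernel of [h], so [h] and then [q] are
    zero. *)
Lemma in_transport_generated I N : is_ideal I ->
  (forall S : submodule N,
    (forall N' (f : module_hom N' N), in_transport I N' -> forall n, S (f n)) ->
    forall n, S n) -> in_transport I N.
Proof.
move=> idI genN.
pose q := quotient_map (annihilated (Kmod N) idI).
have [P [f [g [fg gf]]]] := Khom_dense (quotient_module (annihilated (Kmod N) idI)).
have [h hE] := Khom_full (module_hom_comp f q).
have h0 n : h n = 0.
  apply: (genN (hom_kernel h)) => N' e DN'.
  apply: (Khom_eq0 (f := module_hom_comp h e)) => k.
  rewrite Khom_comp hE -[LHS]/(f (q (Khom e k))).
  suff -> : q (Khom e k) = 0 by exact: mh0.
  rewrite -(mh0 q); apply/quotient_mapP; rewrite subr0 => x Ix /=.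
  by rewrite -mh_linear DN' // mh0.
move=> m; suff : q m = q 0 by move/quotient_mapP; rewrite subr0.
rewrite -(fg (q m)) -(fg (q 0)); congr (g _).
have hz : h = zero_hom N P by apply: module_hom_inj.
have := hE; rewrite hz => zE.
by rewrite -2![f _]/(module_hom_comp f q _) -zE !Khom_zero.
Qed.

Lemma in_transportP I N : is_ideal I ->
  in_transport I N <-> annihilates N (transport I).
Proof.
move=> idI; split=> [DN n x|N0]; first exact.
pose J := ideal_submodule unitsB (transport_ideal I).
(* Each [n] in a module of the class gives a map from [B / J], sending the class of [b] to [n b];
   these maps are jointly injective by definition of [J]. *)
have DJ : in_transport I (quotient_module J).
  apply: in_transport_cogenerated => q; have [b ->] := quotient_map_surj q => q0.
  rewrite -(mh0 (quotient_map J)); apply/quotient_mapP; rewrite subr0 => N' DN' n.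
  have nJ x : J x -> orbit_map unitsB n x = 0 by move=> /(_ N' DN' n).
  by have := q0 _ (quotient_lift nJ) DN'; rewrite quotient_liftE.
(* The orbit map of any [n] factors through [B / J], and [n = n u] lies in its image. *)
apply: in_transport_generated => // S SN n; have [u <-] := um_act_unit unitsB n.
have nJ x : J x -> orbit_map unitsB n x = 0 by apply: N0.
by have := SN _ (quotient_lift nJ) DJ (quotient_map J u); rewrite quotient_liftE.
Qed.

(** If [L] contains the products of [J], then [B / L] is an extension of two modules killed by [J].
    Hence products of two elements of [I] kill its image under [K], so [I] does too, and this forces
    [J] into [L]. *)
Lemma transport_idempotent I : idempotent_ideal I -> idempotent_ideal (transport I).
Proof.
move=> [idI I2]; split=> [|L idL LJ]; first exact: transport_ideal.
set J := transport I in LJ; have idJ : is_ideal J by exact: transport_ideal.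
pose N := quotient_module (ideal_submodule unitsB idL).
pose pi := quotient_map (ideal_submodule unitsB idL).
(* If [N] is in the class then [J] kills it, so for [x] in [J] with left unit [u], [pi x] is [pi u]
   acted on by [x], that is 0. *)
suff DN : in_transport I N.
  move=> x Jx; have [u ux] := leftB x.
  have : pi x = pi 0.
    rewrite -ux -[u ** x]/(um_act (u : regular_module unitsB) x) mh_linear.
    by rewrite mh0 Jx.
  by move/quotient_mapP; rewrite subr0.
pose q := quotient_map (annihilated N idJ).
have DQ : in_transport I (quotient_module (annihilated N idJ)).
  apply/in_transportP => // s x Jx; have [n ->] := quotient_map_surj s.
  have [b ->] := quotient_map_surj n.
  rewrite -!mh_linear -(mh0 (quotient_map (annihilated N idJ))).
  apply/quotient_mapP; rewrite subr0 => y Jy; rewrite -mh_linear -(mh0 pi).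
  apply/quotient_mapP; rewrite subr0; apply: LJ => //.
  by have [_ _ _ JM] := idJ; case: (JM x b Jx).
move=> m x Ix; pose Ann y := forall k : Kmod N, um_act k y = 0.
suff: Ann x by apply.
(* Idempotency reduces the claim to products [x ** y] with both factors in [I]. *)
apply: (I2 Ann) => // {x Ix} [|x y Ix Iy {}m].
  split=> [k|x y Ax Ay k|c x Ax k|x y Ax].
  - exact: um_actr0.
  - by rewrite um_actDr Ax Ay addr0.
  - have [u ux] := unitsA [:: x].
    by rewrite -(ux x) ?mem_head // nuscaleAr -um_actA Ax um_act0.
  - by split=> k; rewrite -um_actA Ax // um_act0.
have [P [g [gm mg]]] := orbit_transport (um_act m x).
have qg p : q (g p) = 0.
  move: p; apply: (Khom_eq0 (f := module_hom_comp q g)) => k.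
  rewrite Khom_comp; have [a ->] := gm k.
  by rewrite 2!mh_linear (DQ _ x) // um_act0.
(* [X] is a copy of the image of [g], which lies in the part of [N] killed by [J]. So [X] is in the
   class, and [y] kills all values of [Khom g], which factors through [Kmod X]. *)
pose X := quotient_module (hom_kernel g).
have DX : in_transport I X.
  apply/in_transportP => // s z Jz; have [p ->] := quotient_map_surj s.
  rewrite -mh_linear -(mh0 (quotient_map (hom_kernel g))).
  apply/quotient_mapP; rewrite subr0 /= mh_linear.
  have /quotient_mapP : q (g p) = q 0 by rewrite qg mh0.
  by rewrite subr0; apply.
pose l := quotient_lift (S := hom_kernel g) (f := g) (fun _ => id).
have gE k : Khom g k = Khom l (Khom (quotient_map (hom_kernel g)) k).
  rewrite -Khom_comp; congr (Khom _ k).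
  by apply: module_hom_inj => p; apply/esym/quotient_liftE.
rewrite -um_actA; have [u <-] := um_act_unit unitsA (um_act m x).
by have [k <-] := mg u; rewrite gE -mh_linear DX // mh0.
Qed.

End Transport.

(** * Transport back along the quasi-inverse *)

Section TransportInverse.
Variables (F : fieldType) (A B : nuAlgType F).
Hypotheses (unitsA : right_local_units A) (unitsB : right_local_units B).
Hypothesis leftA : left_units A.
Variables (G : functor (unital_modules A) (unital_modules B)).
Variables (H : functor (unital_modules B) (unital_modules A)).
Hypothesis HG : naturally_isomorphic (functor_comp H G) (functor_id _).
Hypothesis GH : naturally_isomorphic (functor_comp G H) (functor_id _).

Lemma annihilates_unit (M : unital_module A) (I : set A) :
  annihilates (H (G M) : unital_module A) I <-> annihilates M I.
Proof.
have [eta [eps [_ ee ee']]] := HG.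
pose f : module_hom (H (G M) : unital_module A) M := eta M.
pose g : module_hom M (H (G M) : unital_module A) := eps M.
have fK : cancel f g.
  move=> m; pose ev (h : module_hom (H (G M)) (H (G M))) := h m.
  exact: (congr1 ev (ee M)).
have gK : cancel g f.
  by move=> m; apply: (congr1 (fun h : module_hom M M => h m) (ee' M)).
split=> MI m x Ix.
  by rewrite -(gK m) -mh_linear MI // mh0.
by rewrite -(fK m) -mh_linear MI // mh0.
Qed.

(** By [in_transportP] the modules defining the double transport are those killed by [I]. The
    annihilator of all of them is [I], because [A / I] is among them and left units make its
    annihilator [I]. *)
Lemma transportK (I : set A) : is_ideal I -> transport G (transport H I) = I.
Proof.
move=> idI; have Hff := retract_faithful GH; have Hfull := equivalence_full GH HG.
have Hdense := section_dense HG.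
have DE M : in_transport G (transport H I) M <-> annihilates M I.
  apply: iff_trans (annihilates_unit M I); apply: iff_sym.
  exact: (in_transportP unitsA unitsB Hff Hfull Hdense (G M) idI).
apply/seteqP; split=> x Jx; last by move=> M /DE MI m; apply: MI.
pose J := ideal_submodule unitsA idI; have [u ux] := leftA x.
have := Jx (quotient_module J) _ (quotient_map J u).
rewrite -mh_linear -[um_act _ x]/(u ** x) ux.
rewrite -(mh0 (quotient_map J)) => E.
suff /E/quotient_mapP : in_transport G (transport H I) (quotient_module J).
  by rewrite subr0.
apply/DE => q y Iy; have [b ->] := quotient_map_surj q.
rewrite -mh_linear -(mh0 (quotient_map J)); apply/quotient_mapP; rewrite subr0.
by have [_ _ _ IM] := idI; case: (IM y b Iy).
Qed.

(** A larger ideal kills fewer modules, and fewer modules have a larger annihilator. *)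
Lemma transport_le (I I' : set A) :
  (I `<=` I')%classic -> (transport H I `<=` transport H I')%classic.
Proof. by move=> II' b Jb N DN; apply: Jb => m x /II'; apply: DN. Qed.

End TransportInverse.

(** * Idempotent ideals are graded *)

(* For [m = - n.+1] the polynomial [m (m - 1) ... (m - j + 1) / j!] takes the
   value [(-1)^j 'C(n + j, j)]. *)
Definition int_binomial (j : nat) (m : int) : int :=
  match m with
  | Posz n => 'C(n, j)%:Z
  | Negz n => (-1) ^+ j * 'C(n + j, j)%:Z
  end.

Lemma int_binomial0 m : int_binomial 0 m = 1.
Proof. by case: m => n; rewrite /= bin0 ?mul1r. Qed.

Lemma int_binomialS j m :
  int_binomial j.+1 (m + 1) - int_binomial j.+1 m = int_binomial j m.
Proof.
case: m => [n|[|n]].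
- by rewrite -PoszD addn1 /= binS PoszD [_ + Posz 'C(n, j)]addrC addrK.
(* The case [m = -1], where [m + 1] leaves the negative branch. *)
- by rewrite NegzE addNr /= bin0n add0r !add0n !binn !mulr1 exprS mulN1r opprK.
have -> : Negz n.+1 + 1 = Negz n.
  by rewrite !NegzE -[n.+2]addn1 PoszD opprD addrNK.
rewrite /= addSn binS PoszD -mulrBr opprD addrA subrr sub0r addSnnS.
by rewrite exprS mulN1r mulrN mulNr opprK.
Qed.

Section IdempotentGraded.
Variables (F : fieldType) (Gamma : digraph).
Local Notation L := (leavitt F Gamma).
Local Notation homog := (@lpa_homog F Gamma).
Local Notation act := (@lpa_act F Gamma).

Lemma lpa_homog_decomposition (x : L) : exists s : seq (int * L),
  (forall p, p \in s -> homog p.1 p.2) /\ x = \sum_(p <- s) p.2.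
Proof.
elim/presented_ind: x => t.
elim: t => [g||t [s [hs sE]] t' [r [hr rE]]|a t [s [hs sE]]
  |t [s [hs sE]] t' [r [hr rE]]].
- exists [:: (lpa_gdeg g, pgen (@lpa_rel F Gamma) g)]; rewrite big_seq1; split=> //.
  by move=> p; rewrite mem_seq1 => /eqP ->; apply: lpa_homog_gen.
- by exists [::]; rewrite big_nil.
- exists (s ++ r); rewrite presented_piD sE rE big_cat; split=> // p.
  by rewrite mem_cat => /orP[/hs|/hr].
- exists [seq (p.1, a *: p.2) | p <- s].
  rewrite presented_piZ sE big_map scaler_sumr; split=> // _ /mapP[p /hs hp ->].
  exact: lpa_homogZ.
- exists [seq (p.1 + q.1, p.2 ** q.2) | p <- s, q <- r].
  rewrite presented_piM sE rE numul_suml big_allpairs_dep; split.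
    by move=> _ /allpairsP[[p q] /= [/hs hp /hr hq ->]]; apply: lpa_homogM.
  apply: eq_bigr => p _ /=; elim: (r) => [|q qs IHr].
    by rewrite !big_nil numulr0.
  by rewrite !big_cons numulDr IHr.
Qed.

Lemma lpa_actE (x : L) : exists s : seq (int * L),
  [/\ forall p, p \in s -> homog p.1 p.2, x = \sum_(p <- s) p.2
    & forall w k, act x w k = \sum_(p <- s) p.2 ** w (k - p.1)].
Proof.
have [s [hs ->]] := lpa_homog_decomposition x; exists s; split=> // w k.
rewrite lpa_act_sum !big_seq; apply: eq_bigr => p /hs hp.
exact: lpa_act_homog.
Qed.

Definition fdiff (w : int -> L) (k : int) : L := w (k + 1) - w k.

Lemma fdiff_act x w : fdiff (act x w) = act x (fdiff w).
Proof.
have [s [_ _ E]] := lpa_actE x; apply/funext => k.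
rewrite /fdiff !E -sumrB; apply: eq_bigr => p _.
by rewrite numulDr numulrN addrAC.
Qed.

(** By Newton's expansion these are, modulo [I], the combinations of binomial sequences of degree
    less than [j] with coefficients in the algebra. *)
Fixpoint polynomial_mod (I : set L) (j : nat) (w : int -> L) : Prop :=
  if j is i.+1 then polynomial_mod I i (fdiff w) else forall k, I (w k).

Section FixedIdeal.
Variable I : set L.
Hypothesis idI : is_ideal I.

Lemma polynomial_mod_act j x w :
  polynomial_mod I j w -> polynomial_mod I j (act x w).
Proof.
elim: j w => [|j IHj] w /= wI; last by rewrite fdiff_act; apply: IHj.
have [s [_ _ E]] := lpa_actE x; move=> k; rewrite E.
apply: ideal_sum_seq => // p _ _; have [_ _ _ IM] := idI.
by case: (IM _ p.2 (wI (k - p.1))).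
Qed.

(** Differences commute with the action, which reduces to [j = 0]. There [w] is constant modulo [I],
    so replacing its values by [w 0] costs an element of [I] and leaves [x ** w 0], also in [I]. *)
Lemma polynomial_mod_drop j x w :
  I x -> polynomial_mod I j.+1 w -> polynomial_mod I j (act x w).
Proof.
move=> Ix; elim: j w => [|j IHj] w wI; last first.
  by move: wI => /IHj; rewrite -fdiff_act.
have [I0 ID _ IM] := idI.
have wI0 k : I (w k - w 0).
  elim/int_rect: k => [|n IHn|n IHn]; first by rewrite subrr.
    rewrite -addn1 PoszD -(subrK (w n%:Z) (w _)) -addrA; apply: ID => //.
    exact: wI.
  have := wI (- n.+1%:Z); rewrite /fdiff -addn1 PoszD opprD addrNK => /(idealN idI).
  rewrite opprB => wn; rewrite -(subrK (w (- n%:Z)) (w _)) -addrA.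
  exact: ID.
have [s [_ xE E]] := lpa_actE x; move=> k; rewrite E.
have -> : \sum_(p <- s) p.2 ** w (k - p.1) =
    \sum_(p <- s) p.2 ** (w (k - p.1) - w 0) + x ** w 0.
  rewrite xE numul_suml -big_split /=; apply: eq_bigr => p _.
  by rewrite -numulDr subrK.
apply: ID; last by case: (IM x (w 0) Ix).
by apply: ideal_sum_seq => // p _ _; case: (IM _ p.2 (wI0 (k - p.1))).
Qed.

Lemma polynomial_mod_binomial j (u : L) :
  polynomial_mod I j.+1 (fun k => u *~ int_binomial j k).
Proof.
have [I0 _ _ _] := idI.
elim: j => [|j IHj].
  by move=> k; rewrite /fdiff !int_binomial0 subrr.
have -> // : polynomial_mod I j.+2 (fun k => u *~ int_binomial j.+1 k) =
  polynomial_mod I j.+1 (fun k => u *~ int_binomial j k).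
congr (polynomial_mod I j.+1); apply/funext => k.
by rewrite /fdiff -mulrzBr int_binomialS.
Qed.

End FixedIdeal.

(** The elements sending all sequences of order [j.+1] into [I] form an ideal. It contains the
    products from [I]: the right factor lowers the order by one, and induction handles the left
    factor. *)
Lemma idempotent_act (I : set L) j x w : idempotent_ideal I ->
  I x -> polynomial_mod I j w -> forall k, I (act x w k).
Proof.
move=> [idI I2]; elim: j x w => [|j IHj] x w Ix wI.
  exact: (polynomial_mod_act idI x (j := 0)).
have [I0 ID IZ IM] := idI.
pose K (z : L) := forall v, polynomial_mod I j.+1 v -> forall k, I (act z v k).
suff /(_ x Ix w wI) : (I `<=` K)%classic by [].
apply: I2 => [|y z Iy Iz v vI]; last first.
  by rewrite lpa_actM; apply: IHj => //; apply: polynomial_mod_drop.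
split=> [v _ k|y z Ky Kz v vI k|a y Ky v vI k|y z Ky].
- by rewrite lpa_act0.
- by rewrite lpa_actD; apply: ID; [apply: Ky|apply: Kz].
- by rewrite lpa_actZ; apply/IZ/Ky.
split=> v vI.
  by rewrite lpa_actM; apply: (polynomial_mod_act idI z (j := 0)); apply: Ky.
by rewrite lpa_actM; apply: Ky; apply: polynomial_mod_act.
Qed.

Lemma lpa_right_units : right_local_units L.
Proof.
move=> s; suff [us usP] : exists us : seq {classic vertex Gamma}, forall vs,
    uniq vs -> {subset us <= vs} -> forall x, x \in s -> x ** lpa_vsum F vs = x.
  exists (lpa_vsum F (undup us)); apply: usP; first exact: undup_uniq.
  by move=> v; rewrite mem_undup.
elim: s => [|x s [us IHs]]; first by exists [::].
have [ws xP] := lpa_local_unit x; exists (ws ++ us) => vs uvs sub y.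
rewrite in_cons => /predU1P[->|]; [apply: xP|apply: IHs] => // v vP; apply: sub;
  by rewrite mem_cat vP ?orbT.
Qed.

Lemma idempotent_components (I : set L) (N : nat) (a : int) (s : seq (int * L)) :
  idempotent_ideal I -> (forall p, p \in s -> homog p.1 p.2) ->
  (forall p, p \in s -> (a <= p.1 < a + N%:Z)%R) ->
  I (\sum_(p <- s) p.2) -> forall d, I (\sum_(p <- s | p.1 == d) p.2).
Proof.
move=> idemI; have [idI _] := idemI; have [I0 ID _ _] := idI.
elim: N a s => [|N IHN] a s hs sN Is d.
  rewrite big_seq_cond big_pred0 // => p; apply/negP => /andP[/sN].
  by rewrite addr0 => /andP[/le_lt_trans h /h]; rewrite ltxx.
have Ia : I (\sum_(p <- s | p.1 == a) p.2).
  have [u us] := lpa_right_units [seq p.2 | p <- s].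
  (* At [a + N] a component of degree [p.1] is multiplied by [u] times the binomial of [a + N - p.1]
     over [N]: this is 1 for [p.1 = a], and 0 for the higher degrees, whose upper entry lies between
     0 and [N - 1]. *)
  have := idempotent_act idemI Is (polynomial_mod_binomial idI N u) (a + N%:Z).
  rewrite lpa_act_sum; congr I; rewrite [RHS]big_mkcond !big_seq.
  apply: eq_bigr => p ps; rewrite (lpa_act_homog _ _ (hs p ps)).
  case: eqP => [->|/eqP pa].
    by rewrite addrC addrA addNr add0r /= binn us // map_f.
  have /andP[ap pN] := sN p ps.
  have {}ap : a < p.1 by rewrite lt_neqAle eq_sym pa.
  have : 0 <= a + N%:Z - p.1 < N%:Z.
    rewrite subr_ge0 ltrBlDr [N%:Z + _]addrC ltrD2r ap andbT.
    by rewrite -ltzD1 -addrA -PoszD addn1.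
  by case: (a + N%:Z - p.1) => // n /= nN; rewrite bin_small // mulr0z numulr0.
have [->//|da] := eqVneq d a.
have -> : \sum_(p <- s | p.1 == d) p.2 =
    \sum_(p <- [seq p <- s | p.1 != a] | p.1 == d) p.2.
  rewrite big_filter_cond; apply: eq_bigl => p.
  by case: (eqVneq p.1 d) => [->|]; rewrite ?andbF ?da.
apply: (IHN (a + 1)).
- by move=> p; rewrite mem_filter => /andP[_ /hs].
- move=> p; rewrite mem_filter => /andP[pa /sN /andP[ap pN]].
  by rewrite -addrA -PoszD add1n pN andbT lezD1 lt_neqAle eq_sym pa.
rewrite big_filter; move: Is; rewrite (bigID (fun p => p.1 == a)) /= => Is.
rewrite -[X in I X](addKr (\sum_(p <- s | p.1 == a) p.2)).
by apply: ID => //; apply: idealN.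
Qed.

Lemma idempotent_graded (I : set L) :
  idempotent_ideal I -> is_graded_ideal homog I.
Proof.
move=> idemI; have [idI _] := idemI; split=> // x Ix.
have [s [hs xE]] := lpa_homog_decomposition x.
pose ds := undup [seq p.1 | p <- s].
exists [seq (d, \sum_(p <- s | p.1 == d) p.2) | d <- ds]; split.
  move=> _ /mapP[d _ ->] /=; split.
    rewrite big_seq_cond; apply: big_ind.
    - exact: lpa_homog0.
    - by move=> y z; apply: lpa_homogD.
    - by move=> p /andP[/hs hp /eqP <-].
  (* [M] bounds every degree in absolute value, so all degrees lie in the window of [2M + 1]
     integers starting at [-M]. *)
  pose M := (\sum_(p <- s) `|p.1|)%N.
  apply: (idempotent_components (N := (M + M.+1)%N) (a := - M%:Z)) => //.
    move=> p ps; have pM : (`|p.1| <= M)%N.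
      by rewrite /M (big_rem p) //= leq_addr.
    rewrite PoszD addrA addNr add0r -addn1 PoszD ltzD1 -ler_norml.
    by rewrite -abszE lez_nat.
  by rewrite -xE.
rewrite big_map /= {1}xE; under [RHS]eq_bigr do rewrite big_mkcond /=.
rewrite exchange_big /= !big_seq; apply: eq_bigr => p ps.
rewrite -big_mkcond /= (eq_bigl (xpred1 p.1)) => [|d]; last by rewrite eq_sym.
rewrite -big_filter filter_pred1_uniq ?undup_uniq ?big_seq1 //.
by rewrite mem_undup map_f.
Qed.

End IdempotentGraded.

(** * Graded ideals are idempotent *)

Section GradedIdempotent.
Variables (F : fieldType) (Gamma : digraph).
Local Notation L := (leavitt F Gamma).
Local Notation homog := (@lpa_homog F Gamma).
Local Notation vtx := {classic vertex Gamma}.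
Local Notation arr := {classic arrow Gamma}.

Definition lpa_vertex (v : vtx) : L := pgen (@lpa_rel F Gamma) (GVertex v).
Definition lpa_arrow (e : arr) : L := pgen (@lpa_rel F Gamma) (GArrow e).
Definition lpa_ghost (e : arr) : L := pgen (@lpa_rel F Gamma) (GGhost e).
Definition src (e : arr) : vtx := source e.
Definition tgt (e : arr) : vtx := target e.

Local Notation V := lpa_vertex.
Local Notation E := lpa_arrow.
Local Notation G := lpa_ghost.

Lemma src_arrow e : V (src e) ** E e = E e.
Proof. by rewrite -[LHS]presented_piM; apply/lpa_relE; constructor. Qed.

Lemma arrow_tgt e : E e ** V (tgt e) = E e.
Proof. by rewrite -[LHS]presented_piM; apply/lpa_relE; constructor. Qed.

Lemma tgt_ghost e : V (tgt e) ** G e = G e.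
Proof. by rewrite -[LHS]presented_piM; apply/lpa_relE; constructor. Qed.

Lemma ghost_src e : G e ** V (src e) = G e.
Proof. by rewrite -[LHS]presented_piM; apply/lpa_relE; constructor. Qed.

Lemma ghost_arrow e f : G e ** E f = if e == f then V (tgt e) else 0.
Proof.
rewrite -[LHS]presented_piM; case: eqP => [<-|ef].
  by apply/lpa_relE; constructor.
by rewrite -presented_pi0; apply/lpa_relE; constructor.
Qed.

Lemma vertexM u v : V u ** V v = if v == u then V v else 0.
Proof. exact: lpa_vertexM. Qed.

Lemma vertex_arrow u e : V u ** E e = if src e == u then E e else 0.
Proof.
rewrite -{1}src_arrow numulA vertexM; case: eqP => _; first exact: src_arrow.
exact: numul0r.
Qed.

Lemma ghost_vertex e u : G e ** V u = if src e == u then G e else 0.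
Proof.
rewrite -{1}ghost_src -numulA vertexM [u == _]eq_sym; case: eqP => [<-|_].
  exact: ghost_src.
exact: numulr0.
Qed.

(* [real_path p v] is the product of the arrows of [p] followed by the vertex
   [v]; it is 0 unless [p] is a path ending at [v], the empty path included. *)
Definition real_path (p : seq arr) (v : vtx) : L :=
  foldr (fun e x => E e ** x) (V v) p.

(** The ghosts come in reverse order, as in [(e f)^* = f^* e^*], with [v] on the left. *)
Definition ghost_path (p : seq arr) (v : vtx) : L :=
  foldr (fun e x => x ** G e) (V v) p.

(** Sequences of arrows need not be composable, so this and the following product rules are
    dichotomies with 0 as the degenerate case. *)
Lemma vertex_path u p v :
  V u ** real_path p v = real_path p v \/ V u ** real_path p v = 0.
Proof.
case: p => [|e p] /=.
  by rewrite vertexM; case: eqP; [left|right].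
by rewrite numulA vertex_arrow; case: eqP; [left|right; rewrite numul0r].
Qed.

Lemma ghost_path_vertex p v u :
  ghost_path p v ** V u = ghost_path p v \/ ghost_path p v ** V u = 0.
Proof.
case: p => [|e p] /=.
  by rewrite vertexM; case: eqP => [->|]; [left|right].
by rewrite -numulA ghost_vertex; case: eqP; [left|right; rewrite numulr0].
Qed.

Lemma path_vertex p v : real_path p v ** V v = real_path p v.
Proof.
elim: p => [|e p IHp] /=; first by rewrite vertexM eqxx.
by rewrite -numulA IHp.
Qed.

Lemma path_rcons p e :
  real_path (rcons p e) (tgt e) = real_path p (src e) ** E e.
Proof.
elim: p => [|f p IHp] /=; first by rewrite arrow_tgt src_arrow.
by rewrite IHp numulA.
Qed.

Lemma ghost_path_rcons p e :
  ghost_path (rcons p e) (tgt e) = G e ** ghost_path p (src e).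
Proof.
elim: p => [|f p IHp] /=; first by rewrite tgt_ghost ghost_src.
by rewrite IHp numulA.
Qed.

Lemma path_mul p v q w :
  real_path p v ** real_path q w = real_path (p ++ q) w \/
  real_path p v ** real_path q w = 0.
Proof.
elim: p => [|e p] /=; first exact: vertex_path.
by rewrite -numulA => -[]->; [left|right; rewrite numulr0].
Qed.

Lemma ghost_path_mul p v q w :
  ghost_path p v ** ghost_path q w = ghost_path (q ++ p) v \/
  ghost_path p v ** ghost_path q w = 0.
Proof.
elim: q => [|e q] /=; first exact: ghost_path_vertex.
by rewrite numulA => -[]->; [left|right; rewrite numul0r].
Qed.

Lemma ghost_real_cons e p v f q w :
  ghost_path (e :: p) v ** real_path (f :: q) w =
  if e == f then ghost_path p v ** (V (tgt e) ** real_path q w) else 0.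
Proof.
rewrite /= -numulA (numulA (G e)) ghost_arrow; case: eqP => // _.
by rewrite numul0r numulr0.
Qed.

(** (CK1) cancels common initial arrows, so a nonzero product leaves the tail [r] of the longer
    sequence; its length is recorded for the degree count in [monomialM]. *)
Lemma ghost_real p v q w : [\/ ghost_path p v ** real_path q w = 0,
  exists2 r, size q = (size p + size r)%N &
    ghost_path p v ** real_path q w = real_path r w
  | exists2 r, size p = (size q + size r)%N &
    ghost_path p v ** real_path q w = ghost_path r v].
Proof.
elim: p q => [|e p IHp] [|f q].
- case: (vertex_path v [::] w) => /= ->; last by constructor 1.
  by constructor 2; exists [::].
- case: (vertex_path v (f :: q) w) => /= ->; last by constructor 1.
  by constructor 2; exists (f :: q).
- case: (ghost_path_vertex (e :: p) v w) => /= ->; last by constructor 1.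
  by constructor 3; exists (e :: p).
rewrite ghost_real_cons; case: eqP => _; last by constructor 1.
case: (vertex_path (tgt e) q w) => ->; last by constructor 1; rewrite numulr0.
case: (IHp q) => [->|[r qr ->]|[r pr ->]]; first by constructor 1.
  by constructor 2; exists r; rewrite //= qr.
by constructor 3; exists r; rewrite //= pr.
Qed.

Lemma real_path_eq0_or p v :
  real_path p v = 0 \/ ghost_path p v ** real_path p v = V v.
Proof.
elim: p => [|e p IHp]; first by right; rewrite /= vertexM eqxx.
rewrite ghost_real_cons eqxx /=.
case: (vertex_path (tgt e) p v) => pE; last first.
  by left; rewrite -arrow_tgt -numulA pE numulr0.
by case: IHp => [->|<-]; [left; rewrite numulr0|right; rewrite pE].
Qed.

Lemma ghost_path_eq0_or p v :
  ghost_path p v = 0 \/ ghost_path p v ** real_path p v = V v.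
Proof.
elim: p => [|e p IHp]; first by right; rewrite /= vertexM eqxx.
rewrite ghost_real_cons eqxx numulA /=.
case: (ghost_path_vertex p v (tgt e)) => pE; last first.
  by left; rewrite -tgt_ghost numulA pE numul0r.
by case: IHp => [->|<-]; [left; rewrite numul0r|right; rewrite pE].
Qed.

Lemma ghost_real_neq p v q w : size p = size q -> (p, v) <> (q, w) ->
  ghost_path p v ** real_path q w = 0.
Proof.
elim: p q => [|e p IHp] [|f q] // spq neq.
  by rewrite /= vertexM; case: eqP => // wv; case: neq; rewrite wv.
rewrite ghost_real_cons; case: eqP => // ef.
case: (vertex_path (tgt e) q w) => ->; last by rewrite numulr0.
by apply: IHp => [|[pq vw]]; [case: spq|case: neq; rewrite ef pq vw].
Qed.

(** * Truncated (CK2) defects *)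

Section Truncation.
Variable T : seq arr.
Hypothesis uniqT : uniq T.

(* The defect of (CK2) at [v] for the arrows of [T] issued from [v]. *)
Definition gap (v : vtx) : L := V v - \sum_(f <- T | src f == v) E f ** G f.

Lemma gap_vertex v : gap v ** V v = gap v.
Proof.
rewrite /gap numulDl numulNr vertexM eqxx numul_suml_cond; congr (_ - _).
by apply: eq_bigr => f /eqP fv; rewrite -numulA ghost_vertex fv eqxx.
Qed.

(** By (CK1) only the term [f = e] of the sum can survive, once since [T] has no repetition, and it
    cancels [V v ** E e]. *)
Lemma gap_arrow v e : e \in T -> gap v ** E e = 0.
Proof.
move=> eT; rewrite /gap numulDl numulNr numul_suml_cond vertex_arrow.
have gE f : (E f ** G f) ** E e = if f == e then E e else 0.
  rewrite -numulA ghost_arrow; case: eqP => [->|_]; first exact: arrow_tgt.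
  by rewrite numulr0.
under eq_bigr do rewrite gE.
rewrite -big_mkcondr /= (eq_bigl (fun f => (src e == v) && (f == e))); last first.
  by move=> f; case: (eqVneq f e) => [->|]; rewrite ?andbF.
case: (src e == v) => /=; last by rewrite big_pred0 // subr0.
by rewrite -big_filter filter_pred1_uniq // big_seq1 subrr.
Qed.

Lemma gap_idem v : gap v ** gap v = gap v.
Proof.
rewrite {2}/gap numulDr gap_vertex numulrN numul_sumr big_seq_cond big1 ?subr0 //.
by move=> f /andP[fT _]; rewrite numulA gap_arrow // numul0r.
Qed.

(** If the product is not 0, what remains of [q] after cancelling [p] starts with an arrow of [T],
    which [gap v] kills. *)
Lemma gap_ghost_real p v q w : (size p < size q)%N -> {subset q <= T} ->
  gap v ** (ghost_path p v ** real_path q w) = 0.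
Proof.
elim: p q => [|e p IHp] [|f q] // spq qT.
  case: (vertex_path v (f :: q) w) => ->; last exact: numulr0.
  by rewrite /= numulA gap_arrow ?numul0r // qT ?mem_head.
rewrite ghost_real_cons; case: eqP => _; last exact: numulr0.
case: (vertex_path (tgt e) q w) => ->; last by rewrite !numulr0.
by apply: IHp => // g gq; rewrite qT // in_cons gq orbT.
Qed.

End Truncation.

(* The triple [(p, v, q)] stands for the monomial [p v q^*]. *)
Local Notation monomial_index := (seq arr * vtx * seq arr)%type.

Definition lpa_monomial (i : monomial_index) : L :=
  real_path i.1.1 i.1.2 ** ghost_path i.2 i.1.2.

Definition monomial_degree (i : monomial_index) : int :=
  (size i.1.1)%:Z - (size i.2)%:Z.

Definition monomial_span (P : monomial_index -> Prop) (x : L) : Prop :=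
  exists s : seq (F * monomial_index),
    (forall c, c \in s -> P c.2) /\ x = \sum_(c <- s) c.1 *: lpa_monomial c.2.

Section Span.
Variable P : monomial_index -> Prop.

Lemma monomial_span0 : monomial_span P 0.
Proof. by exists [::]; rewrite big_nil. Qed.

Lemma monomial_spanD x y :
  monomial_span P x -> monomial_span P y -> monomial_span P (x + y).
Proof.
move=> [s [Ps ->]] [r [Pr ->]]; exists (s ++ r); rewrite big_cat; split=> // c.
by rewrite mem_cat => /orP[/Ps|/Pr].
Qed.

Lemma monomial_spanZ a x : monomial_span P x -> monomial_span P (a *: x).
Proof.
move=> [s [Ps ->]]; exists [seq (a * c.1, c.2) | c <- s]; split.
  by move=> _ /mapP[c /Ps Pc ->].
by rewrite big_map scaler_sumr; apply: eq_bigr => c _; rewrite scalerA.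
Qed.

Lemma monomial_span_mem i : P i -> monomial_span P (lpa_monomial i).
Proof.
move=> Pi; exists [:: (1, i)]; rewrite big_seq1 scale1r; split=> // c.
by rewrite mem_seq1 => /eqP ->.
Qed.

Lemma monomial_span_sum (S : eqType) (s : seq S) (Q : pred S) (H : S -> L) :
  (forall i, i \in s -> Q i -> monomial_span P (H i)) ->
  monomial_span P (\sum_(i <- s | Q i) H i).
Proof.
move=> PH; rewrite big_seq_cond; apply: big_ind.
- exact: monomial_span0.
- by move=> x y; apply: monomial_spanD.
- by move=> i /andP[]; apply: PH.
Qed.

End Span.

Lemma monomialM i j : lpa_monomial i ** lpa_monomial j = 0 \/
  exists2 k, monomial_degree k = monomial_degree i + monomial_degree j &
    lpa_monomial i ** lpa_monomial j = lpa_monomial k.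
Proof.
case: i j => [[p v] q] [[p' v'] q']; rewrite /lpa_monomial /monomial_degree /=.
rewrite -numulA (numulA (ghost_path q v)).
case: (ghost_real q v p' v') => [->|[r sr ->]|[r sr ->]].
- by left; rewrite numul0r numulr0.
- rewrite numulA; case: (path_mul p v r v') => ->; last by left; rewrite numul0r.
  right; exists (p ++ r, v', q') => //=.
  by rewrite size_cat sr !PoszD; ring.
- case: (ghost_path_mul r v q' v') => ->; last by left; rewrite numulr0.
  right; exists (p, v, q' ++ r) => //=.
  by rewrite size_cat sr !PoszD; ring.
Qed.

Lemma lpa_homog_span n x : homog n x ->
  monomial_span (fun i => monomial_degree i = n) x.
Proof.
elim=> {n x} [g|n|n x y _ IHx _ IHy|n a x _ IHx
  |m n x y _ [s [hs ->]] _ [r [hr ->]]].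
- case: g => [v|e|e].
  + have -> : pgen (@lpa_rel F Gamma) (GVertex v) =
        lpa_monomial ([::], v, [::]).
      by rewrite /lpa_monomial /= vertexM eqxx.
    exact: monomial_span_mem.
  + have -> : pgen (@lpa_rel F Gamma) (GArrow e) =
        lpa_monomial ([:: e], tgt e, [::]).
      by rewrite /lpa_monomial /= -numulA vertexM eqxx arrow_tgt.
    exact: monomial_span_mem.
  + have -> : pgen (@lpa_rel F Gamma) (GGhost e) =
        lpa_monomial ([::], tgt e, [:: e]).
      by rewrite /lpa_monomial /= numulA vertexM eqxx tgt_ghost.
    exact: monomial_span_mem.
- exact: monomial_span0.
- exact: monomial_spanD.
- exact: monomial_spanZ.
rewrite numul_suml; apply: monomial_span_sum => c cs _.
rewrite numul_sumr; apply: monomial_span_sum => d dr _.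
rewrite -nuscaleAl -nuscaleAr; do 2!apply: monomial_spanZ.
case: (monomialM c.2 d.2) => [->|[k kE ->]]; first exact: monomial_span0.
by apply: monomial_span_mem; rewrite kE hs // hr.
Qed.

(** A list may repeat an index, while the multiplications in [gap_terms] detect only the total
    coefficient of each index. *)
Lemma sum_by_index (J : eqType) (s : seq (F * J)) (Q : pred J) (g : J -> L) :
  \sum_(c <- s | Q c.2) c.1 *: g c.2 =
  \sum_(i <- undup [seq c.2 | c <- s] | Q i)
    (\sum_(c <- s | c.2 == i) c.1) *: g i.
Proof.
under [RHS]eq_bigr do rewrite scaler_suml.
rewrite (exchange_big_dep (fun c => Q c.2)) /= => [|i c Qi /eqP -> //].
rewrite big_seq_cond [RHS]big_seq_cond; apply: eq_bigr => c /andP[cs Qc].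
rewrite (eq_bigl (xpred1 c.2)) => [|i]; last first.
  by rewrite eq_sym; case: eqP => [->|]; rewrite ?Qc ?andbF.
by rewrite -big_filter filter_pred1_uniq ?undup_uniq ?mem_undup ?map_f // big_seq1.
Qed.

(** * Descent on the length of monomials *)

Section Descent.
Variables (I K : set L).
Hypotheses (idI : is_ideal I) (idK : is_ideal K).
Hypothesis KI : (K `<=` I)%classic.
Hypothesis IK : forall x y, I x -> I y -> K (x ** y).

Lemma gap_terms (T : seq arr) (k : nat) (n : int) (s : seq (F * monomial_index)) :
  uniq T -> (forall c, c \in s -> monomial_degree c.2 = n) ->
  (forall c, c \in s -> size c.2.1.1 = k \/
     ((k < size c.2.1.1)%N /\ {subset c.2.1.1 <= T})) ->
  I (\sum_(c <- s) c.1 *: lpa_monomial c.2) ->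
  K (\sum_(c <- s | size c.2.1.1 == k) c.1 *:
      (real_path c.2.1.1 c.2.1.2 ** gap T c.2.1.2 ** ghost_path c.2.2 c.2.1.2)).
Proof.
move=> uT sn sk Is; have [I0 ID IZ IM] := idI; have [K0 KD KZ KM] := idK.
pose gm (i : monomial_index) :=
  real_path i.1.1 i.1.2 ** gap T i.1.2 ** ghost_path i.2 i.1.2.
pose ds := undup [seq c.2 | c <- s].
pose C i := \sum_(c <- s | c.2 == i) c.1.
rewrite (sum_by_index s (fun i => size i.1.1 == k) gm) -/ds.
apply: ideal_sum_seq => // -[[p v] q] ids /= /eqP pk.
rewrite /gm /=; set i := (p, v, q) in ids *.
have in_ : monomial_degree i = n.
  by move: ids; rewrite mem_undup => /mapP[c /sn cn ->].
case: (real_path_eq0_or p v) => [->|pp]; first by rewrite !numul0r scaler0.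
case: (ghost_path_eq0_or q v) => [->|qq]; first by rewrite numulr0 scaler0.
have Ci : I (C i *: gap T v).
  (* Only the index [i] survives. Longer [p'] are killed by the gap; for [p'] of length [k] the
     common degree forces [q'] to have the length of [q], and (CK1) kills every other index. *)
  have -> : C i *: gap T v = gap T v ** ghost_path p v **
      (\sum_(c <- s) c.1 *: lpa_monomial c.2) ** real_path q v.
    rewrite numul_sumr numul_suml /C scaler_suml big_mkcond !big_seq.
    apply: eq_bigr => -[a [[p' v'] q']] cs /=.
    rewrite -nuscaleAr -nuscaleAl /lpa_monomial /= -!numulA.
    case: eqP => [[-> -> ->]|neq].
      by rewrite qq (numulA (ghost_path p v)) pp vertexM eqxx gap_vertex.
    case: (sk _ cs) => /= [p'k|[kp' p'T]]; last first.
      rewrite !numulA -(numulA (gap T v)) gap_ghost_real ?pk //.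
      by rewrite !numul0r scaler0.
    have qq' : size q' = size q.
      move: (sn _ cs); rewrite -in_ /monomial_degree /= p'k pk.
      by move=> /addrI/oppr_inj[].
    have [pp'|/eqP pp'] := eqVneq (p, v) (p', v'); last first.
      rewrite (numulA (ghost_path p v)) ghost_real_neq ?p'k //.
      by rewrite numul0r numulr0 scaler0.
    rewrite (ghost_real_neq qq') ?numulr0 ?scaler0 // => qv.
    by apply: neq; case: pp' => pE _; case: qv => -> ->; rewrite /i pE.
  by case: (IM _ (real_path q v) (IM _ (gap T v ** ghost_path p v) Is).1).
rewrite -/(C i); have [->|C0] := eqVneq (C i) 0; first by rewrite scale0r.
have Ig : I (gap T v).
  by rewrite -[gap T v]scale1r -(mulVf C0) -scalerA; apply: IZ.
(* Doubling the idempotent gap splits the term into two factors that both lie in [I]. *)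
apply: KZ; rewrite -(gap_idem uT) numulA -numulA; apply: IK.
  by case: (IM _ (real_path p v) Ig).
by case: (IM _ (ghost_path q v) Ig).
Qed.

(** The terms [e e^*] subtracted in the gap lengthen both paths, as
    [p e e^* q^* = (p e) (q e)^*]. *)
Lemma gap_monomial (T : seq arr) (i : monomial_index) :
  lpa_monomial i - real_path i.1.1 i.1.2 ** gap T i.1.2 ** ghost_path i.2 i.1.2 =
  \sum_(e <- T | src e == i.1.2)
    lpa_monomial (rcons i.1.1 e, tgt e, rcons i.2 e).
Proof.
case: i => [[p v] q] /=; rewrite /lpa_monomial /=.
rewrite /gap numulDr path_vertex numulDl numulrN numulNr opprD addNKr opprK.
rewrite numul_sumr numul_suml_cond; apply: eq_bigr => e /eqP <-.
by rewrite path_rcons ghost_path_rcons !numulA.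
Qed.

(** Induction on the width [d] of the window of lengths. Subtracting the element of [K] given by
    [gap_terms] trades the shortest monomials for ones an arrow longer over the same [T], so the
    window loses its lower end; at width 0 the sum is empty. *)
Lemma graded_descent (T : seq arr) (n : int) (d k : nat) x :
  uniq T ->
  monomial_span (fun i => [/\ monomial_degree i = n, (k <= size i.1.1 < k + d)%N
    & {subset i.1.1 <= T}]) x -> I x -> K x.
Proof.
move=> uT; elim: d k x => [|d IHd] k x.
  move=> [[|c s] [sP ->]]; first by rewrite big_nil; have [] := idK.
  by have [_ ] := sP c (mem_head _ _); rewrite addn0 ltnNge; case: leqP.
move=> [s [sP xE]] Ix; have [I0 ID IZ IM] := idI; have [K0 KD KZ KM] := idK.
(* At the last step all monomials have the same length and nothing is pushed
   further, so the gap is taken with respect to no arrow. *)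
pose T' := if d is 0%N then [::] else T.
have uT' : uniq T' by rewrite /T'; case: (d).
pose gm (i : monomial_index) :=
  real_path i.1.1 i.1.2 ** gap T' i.1.2 ** ghost_path i.2 i.1.2.
pose y := \sum_(c <- s | size c.2.1.1 == k) c.1 *: gm c.2.
have Ky : K y.
  apply: (gap_terms (n := n)) => //; last by rewrite -xE.
    by move=> c /sP[].
  move=> c /sP[_ /andP[kc ck] cT]; rewrite /T'; case: (d) ck => [|d'] ck.
    by left; apply/eqP; rewrite eqn_leq kc andbT -ltnS -[k.+1]addn1.
  by case: ltngtP kc => // kc _; [right|left].
rewrite -(subrK y x); apply: (KD) => //; apply: (IHd k.+1); last first.
  by apply: ID => //; apply: idealN => //; apply: KI.
have -> : x - y = \sum_(c <- s)
    c.1 *: (lpa_monomial c.2 - (if size c.2.1.1 == k then gm c.2 else 0)).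
  rewrite xE /y [X in _ - X]big_mkcond -sumrB; apply: eq_bigr => c _.
  by rewrite scalerBr; case: ifP; rewrite ?scaler0.
apply: monomial_span_sum => c cs _; apply: monomial_spanZ.
have [cn /andP[kc ck] cT] := sP c cs; case: eqP => [ck'|/eqP ck'].
  rewrite gap_monomial; apply: monomial_span_sum => e eT' _.
  apply: monomial_span_mem; rewrite /= size_rcons ck' leqnn addSn ltnS /=.
  (* An arrow in [T'] exists only for positive [d], so the new length [k.+1] stays below
     [k.+1 + d]. *)
  have [eT d0] : e \in T /\ (0 < d)%N by move: eT'; rewrite /T'; case: (d).
  split; first by rewrite -cn /monomial_degree /= !size_rcons !intS; ring.
    by rewrite -[X in (X <= _)%N]addn0 ltn_add2l.
  by move=> f; rewrite mem_rcons in_cons => /predU1P[->|/cT].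
rewrite subr0; apply: monomial_span_mem; split=> //.
by rewrite ltn_neqAle eq_sym ck' kc addSnnS.
Qed.

End Descent.

Lemma graded_idempotent (I : set L) :
  is_graded_ideal homog I -> idempotent_ideal I.
Proof.
move=> [idI gI]; split=> // K idK IK x /gI[s [sP ->]].
have [I0 ID IZ IM] := idI; have [K0 KD KZ KM] := idK.
apply: ideal_sum_seq => // -[n y] /sP[/= /lpa_homog_span[r [rP yE]] Iy] _.
pose T := undup (flatten [seq c.2.1.1 | c <- r]).
(* [d] exceeds the length of every first path, so the window from 0 to [d] contains them all. *)
pose d := (\sum_(c <- r) (size c.2.1.1).+1)%N.
(* The descent must stay inside [I], so [K] is replaced by its intersection with [I], which still
   contains the products. *)
suff [] : (K `&` I)%classic y by [].
have idKI : is_ideal (K `&` I)%classic.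
  split=> [|a b [Ka Ia] [Kb Ib]|c a [Ka Ia]|a b [Ka Ia]].
  - by [].
  - by split; [apply: KD|apply: ID].
  - by split; [apply: KZ|apply: IZ].
  - by have [? ?] := KM a b Ka; have [? ?] := IM a b Ia; split; split.
apply: (@graded_descent I (K `&` I)%classic idI idKI _ _ T n d 0) => //.
- by move=> a b Ia Ib; split; [apply: IK|case: (IM a b Ia)].
- exact: undup_uniq.
exists r; split=> // c cr; split; first exact: rP.
  by rewrite /d (big_rem c) //= add0n leq_addr.
move=> e ec; rewrite mem_undup; apply/flattenP; exists c.2.1.1 => //.
by apply/mapP; exists c.
Qed.

End GradedIdempotent.

(** * Morita invariance *)

(** Mirror image of [lpa_local_unit]: a sum of enough distinct vertices fixes [x] from the left. *)
Lemma lpa_left_units (F : fieldType) (Gamma : digraph) :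
  left_units (leavitt F Gamma).
Proof.
move=> x; suff [us xP] : exists us : seq {classic vertex Gamma}, forall vs,
    uniq vs -> {subset us <= vs} -> lpa_vsum F vs ** x = x.
  exists (lpa_vsum F (undup us)); apply: xP; first exact: undup_uniq.
  by move=> v; rewrite mem_undup.
have vsum_vertex (v : {classic vertex Gamma}) vs : uniq vs -> v \in vs ->
    lpa_vsum F vs ** lpa_vertex F v = lpa_vertex F v.
  move=> uvs vvs; rewrite /lpa_vsum numul_suml (bigD1_seq v) //= lpa_vertexM eqxx.
  rewrite big1 ?addr0 // => u uv; rewrite lpa_vertexM eq_sym (negPf uv) //.
elim/presented_ind: x => t.
elim: t => [g||s [us IHs] t [ws IHt]|a t [us IHt]|s [us IHs] t [ws IHt]].
- have [v gv] : exists v : {classic vertex Gamma},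
      \pi_(leavitt F Gamma) (FGen g) =
      lpa_vertex F v ** \pi_(leavitt F Gamma) (FGen g).
    case: g => [v|e|e]; [exists v|exists (src e)|exists (tgt e)].
    + by rewrite vertexM eqxx.
    + by rewrite [RHS]src_arrow.
    + by rewrite [RHS]tgt_ghost.
  exists [:: v] => vs uvs vvs.
  by rewrite gv numulA vsum_vertex// vvs ?mem_head.
- by exists [::] => vs _ _; rewrite presented_pi0 numulr0.
- exists (us ++ ws) => vs uvs sub; rewrite presented_piD numulDr IHs ?IHt //.
  + by move=> v vws; apply: sub; rewrite mem_cat vws orbT.
  + by move=> v vus; apply: sub; rewrite mem_cat vus.
- by exists us => vs uvs sub; rewrite presented_piZ -nuscaleAr IHt.
- by exists us => vs uvs sub; rewrite presented_piM numulA IHs.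
Qed.

Lemma order_isomorphic_lattices (d d' : Order.disp_t) (L : latticeType d)
    (L' : latticeType d') (f : L -> L') (g : L' -> L) :
  cancel f g -> cancel g f ->
  {homo f : x y / (x <= y)%O} -> {homo g : x y / (x <= y)%O} ->
  lattice_isomorphic L L'.
Proof.
move=> fK gK fh gh; exists f; split=> [|x y|x y]; first by exists g.
  apply/eqP; rewrite eq_le lexI !fh ?leIl ?leIr //=.
  by rewrite -[leLHS]gK fh // lexI -{2}(fK x) -{3}(fK y) !gh ?leIl ?leIr.
apply/eqP; rewrite eq_le leUx !fh ?leUl ?leUr ?andbT //=.
by rewrite -[leRHS]gK fh // leUx -{1}(fK x) -{2}(fK y) !gh ?leUl ?leUr.
Qed.

Theorem corollary13 (F : fieldType) (Gamma Lambda : digraph) :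
  morita_equivalent (leavitt F Gamma) (leavitt F Lambda) ->
  lattice_isomorphic (graded_ideal F Gamma) (graded_ideal F Lambda).
Proof.
move=> [G [H [HG GH]]].
have rG := @lpa_right_units F Gamma; have rL := @lpa_right_units F Lambda.
have lG := @lpa_left_units F Gamma; have lL := @lpa_left_units F Lambda.
have tH (I : graded_ideal F Gamma) :
    is_graded_ideal (@lpa_homog F Lambda) (transport H I).
  apply/idempotent_graded/(transport_idempotent rG rL lL).
  - exact: retract_faithful GH.
  - exact: equivalence_full GH HG.
  - exact: section_dense HG.
  - exact/graded_idempotent/graded_idealP.
have tG (I : graded_ideal F Lambda) :
    is_graded_ideal (@lpa_homog F Gamma) (transport G I).
  apply/idempotent_graded/(transport_idempotent rL rG lG).
  - exact: retract_faithful HG.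
  - exact: equivalence_full HG GH.
  - exact: section_dense GH.
  - exact/graded_idempotent/graded_idealP.
apply: (order_isomorphic_lattices (f := fun I => GradedIdeal (tH I))
  (g := fun I => GradedIdeal (tG I))).
- move=> I; apply: graded_ideal_inj; apply: transportK => //.
  by have [] := graded_idealP I.
- move=> I; apply: graded_ideal_inj; apply: transportK => //.
  by have [] := graded_idealP I.
- by move=> I J /asboolP IJ; apply/asboolP/transport_le.
- by move=> I J /asboolP IJ; apply/asboolP/transport_le.
Qed.
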